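(* Let $X_1,\dots,X_n$ be independent discrete log-concave random variables and let $S_n=\sum_{i=1}^nX_i$. Then for every real $\alpha>1$, $$\Delta_\alpha(S_n)\ \ge\ c_\alpha\sum_{i=1}^n\Delta_\alpha(X_i),\qquad\text{where } c_\alpha=\frac{\alpha-1}{4(3\alpha-1)}.$$
   Context: A discrete log-concave random variable is an integer-valued random variable $X$ whose probability mass function $p(z)=\mathbb{P}(X=z)$ satisfies $p(z)^2\ge p(z-1)p(z+1)$ for all $z\in\mathbb{Z}$ and whose support $\{z\in\mathbb{Z}:p(z)>0\}$ is contiguous (a set of consecutive integers). For real $\alpha>0$, $\alpha\ne1$, the Rényi entropy power of order $\alpha$ of an integer-valued random variable $X$ with probability mass function $p$ is $N_\alpha(X)=\Bigl(\sum_{z\in\mathbb{Z}}p(z)^\alpha\Bigr)^{-2/(\alpha-1)}$, and $\Delta_\alpha(X)=N_\alpha(X)-1$. *)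

(* Defs.v *)
From HB Require Import structures.
From mathcomp Require Import all_boot all_order all_algebra.
From mathcomp Require Import all_classical all_reals all_analysis.
From mathcomp Require Import measurable_realfun.

Set Implicit Arguments.
Unset Strict Implicit.
Unset Printing Implicit Defensive.

Import Order.TTheory GRing.Theory Num.Theory.
Import numFieldNormedType.Exports.

Local Open Scope classical_set_scope.
Local Open Scope ring_scope.

(* An integer-valued random variable is a real random variable (so that the
   library's [pmf] and the ring structure of measurable functions apply) all
   of whose values are integers. *)
Definition integer_valued d (T : measurableType d) (R : realType)
    (P : probability T R) (X : {RV P >-> R}) : Prop :=
  forall w, X w \is a Num.int.

Definition int_pmf d (T : measurableType d) (R : realType)
    (P : probability T R) (X : {RV P >-> R}) (z : int) : R :=
  pmf X z%:~R.

Definition discrete_log_concave d (T : measurableType d) (R : realType)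
    (P : probability T R) (X : {RV P >-> R}) : Prop :=
  [/\ integer_valued X,
      forall z : int,
        int_pmf X (z - 1) * int_pmf X (z + 1) <= int_pmf X z ^+ 2 &
      forall a b c : int, a <= b -> b <= c ->
        0 < int_pmf X a -> 0 < int_pmf X c -> 0 < int_pmf X b].

(* Mutual independence of a finite family: the product rule on every
   subfamily and all Borel sets. *)
Definition independent_RVs d (T : measurableType d) (R : realType)
    (P : probability T R) (I : finType) (X : I -> {RV P >-> R}) : Prop :=
  forall (J : {set I}) (B : I -> set R), (forall i, measurable (B i)) ->
    P (\bigcap_(i in [set` J]) (X i @^-1` B i)) =
    (\prod_(i in J) P (X i @^-1` B i))%E.

(* The sum over the integers may diverge when alpha < 1; the exponent is then
   positive and [poweR] gives +oo. *)
Definition renyi_power d (T : measurableType d) (R : realType)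
    (P : probability T R) (alpha : R) (X : {RV P >-> R}) : \bar R :=
  ((\esum_(z in [set: int]) (int_pmf X z `^ alpha)%:E)
     `^ (- 2 / (alpha - 1)))%E.

Definition renyi_delta d (T : measurableType d) (R : realType)
    (P : probability T R) (alpha : R) (X : {RV P >-> R}) : \bar R :=
  (renyi_power alpha X - 1)%E.

(* The sum below is taken in the ring {mfun T >-> R}, i.e. pointwise. *)
Definition sum_RV d (T : measurableType d) (R : realType)
    (P : probability T R) (n : nat) (X : 'I_n -> {RV P >-> R})
    : {RV P >-> R} :=
  \sum_(i < n) (X i : {mfun T >-> R}).

Lemma sum_RVE d (T : measurableType d) (R : realType) (P : probability T R)
    (n : nat) (X : 'I_n -> {RV P >-> R}) (w : T) :
  sum_RV X w = \sum_(i < n) X i w.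
Proof. exact: mfun_sum. Qed.

(* Main.v *)
(** Write [tau = alpha / (alpha - 1)] and let [D(p) = sum_(i, j) p i p j (i - j)^2],
    twice the variance.  The variance is the bridge: it is additive over independent
    sums, every integer-valued variable satisfies
    [Delta_alpha <= 4 (2 tau + 1) Var], and every log-concave one satisfies
    [Delta_alpha >= Var].

    Upper bound.  Hoelder's inequality against the test function
    [(L^2 - 1/12 - (z - mu)^2)_+], with [L^2 = (2 tau + 1) (Var + 1/12)], reduces the
    claim to comparing [sum_z (L^2 - 1/12 - (z - mu)^2)_+^tau] with the integral
    of [(L^2 - x^2)_+^tau].  This works once [4 (2 tau + 1) Var >= 2]; for smaller
    variances the single atom nearest to the mean already carries mass at least
    [1 - 2 Var].

    Lower bound.  The autocorrelation [r] of a log-concave pmf [f] is symmetric and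
    log-concave, so its tails decay geometrically and
    [D(f) = sum_n n^2 r n <= (r 0^-2 - 1) / 2].  The same geometric domination of the
    two tails of [f] around its mode gives [r 0 >= M (1 + M^2) / 2] with [M = max f];
    together, [Var <= M^-2 - 1], which is at most [Delta_alpha]. *)

Require Import Defs.
From mathcomp Require Import all_boot all_order all_algebra.
From mathcomp Require Import all_classical all_reals all_analysis.
From mathcomp Require Import measurable_realfun.
From mathcomp Require Import ring lra zify.

Set Implicit Arguments.
Unset Strict Implicit.
Unset Printing Implicit Defensive.

Import Order.TTheory GRing.Theory Num.Theory.
Import numFieldNormedType.Exports.

Local Open Scope ring_scope.

(** * Power sums of parabolas over the integers *)

Lemma sum_sqr_sub (R : comRingType) (n : nat) (f : 'I_n -> R) :
  \sum_i \sum_j (f i - f j) ^+ 2 =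
  2 * n%:R * (\sum_i f i ^+ 2) - 2 * (\sum_i f i) ^+ 2.
Proof.
transitivity (\sum_i (n%:R * f i ^+ 2 - 2 * f i * (\sum_j f j)
                      + \sum_j f j ^+ 2)).
  apply: eq_bigr => i _.
  transitivity (\sum_j (f i ^+ 2 - 2 * f i * f j + f j ^+ 2)).
    by apply: eq_bigr => j _; ring.
  by rewrite big_split sumrB/= sumr_const card_ord -[_ *+ n]mulr_natl -mulr_sumr.
rewrite big_split sumrB/= sumr_const card_ord -mulr_sumr -mulr_suml -mulr_sumr.
rewrite -[_ *+ n]mulr_natl; ring.
Qed.

Lemma sum_ord_sqr (R : realFieldType) (n : nat) :
  (\sum_(i < n) (i%:R : R) = n%:R * (n%:R - 1) / 2) *
  (\sum_(i < n) (i%:R : R) ^+ 2 = n%:R * (n%:R - 1) * (2 * n%:R - 1) / 6).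
Proof.
elim: n => [|n [IH1 IH2]]; first by rewrite !big_ord0 !mul0r.
by split; rewrite big_ord_recr/= ?IH1 ?IH2 -(natr1 n); field.
Qed.

(** Pairwise differences do not involve [mu], and distinct integers in increasing order are at least
    as far apart as their indices; consecutive integers are therefore extremal. *)
Lemma uniq_int_sum_sqr_dev (R : realFieldType) (s : seq int) (mu : R) :
  uniq s ->
  (size s)%:R * ((size s)%:R ^+ 2 - 1) / 12 <= \sum_(z <- s) (z%:~R - mu) ^+ 2.
Proof.
move=> us; set n := size s.
pose t := sort <=%O s.
have st : size t = n by rewrite size_sort.
have lt_t : sorted <%O t by rewrite sort_lt_sorted.
pose x i : int := nth 0 t i.
have xlt (i j : nat) : (i <= j)%N -> (j < n)%N -> (j - i)%:Z <= x j - x i.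
  move=> ij jn; have := subnK ij; move: (j - i)%N => k kij.
  elim: k j kij {ij} jn => [|k IH] j <- jn; first by rewrite add0n subrr.
  have {}IH := IH _ erefl (ltnW jn).
  have : x (k + i)%N < x (k.+1 + i)%N.
    by apply: (sorted_ltn_nth lt_trans) => //; rewrite inE st// ltnW.
  by move: IH; lia.
have xdist (i j : 'I_n) : (i%:R - j%:R) ^+ 2 <= (x i - x j)%:~R ^+ 2 :> R.
  wlog ij : i j / (i <= j)%N.
    move=> H; case: (leqP i j) => [|/ltnW]; first exact: H.
    by move=> /H h; rewrite -[leLHS]sqrrN -[leRHS]sqrrN -rmorphN !opprB.
  rewrite -[leLHS]sqrrN -[leRHS]sqrrN -rmorphN !opprB -natrB//.
  rewrite ler_sqr ?nnegrE//; last first.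
    by rewrite ler0z; apply: le_trans (xlt _ _ ij (ltn_ord j)).
  by rewrite -[X in X <= _]/((j - i)%:Z%:~R) ler_int xlt.
have -> : \sum_(z <- s) (z%:~R - mu) ^+ 2 = \sum_(i < n) ((x i)%:~R - mu) ^+ 2.
  rewrite -(perm_big _ (permEl (perm_sort <=%O s))) /= (big_nth 0) big_mkord.
  by rewrite -/t st.
have [n0|n0] := posnP n; first by rewrite n0 !mul0r sumr_ge0// => i _; exact: sqr_ge0.
have nR : 0 < n%:R :> R by rewrite ltr0n.
rewrite -(ler_pM2l nR).
have A := sum_sqr_sub (fun i : 'I_n => (x i)%:~R - mu).
have B := sum_sqr_sub (fun i : 'I_n => i%:R : R).
have C : \sum_(i < n) \sum_(j < n) (i%:R - j%:R : R) ^+ 2 <=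
   \sum_(i < n) \sum_(j < n) ((x i)%:~R - mu - ((x j)%:~R - mu)) ^+ 2.
  apply: ler_sum => i _; apply: ler_sum => j _.
  apply: le_trans (xdist i j) _.
  by rewrite rmorphB/= opprB addrA subrK.
rewrite A B !sum_ord_sqr in C.
have := sqr_ge0 (\sum_(i < n) ((x i)%:~R - mu)).
lra.
Qed.

Lemma seq_argmax (T : eqType) d (U : orderType d) (F : T -> U) (s : seq T) :
  s != [::] -> exists2 z, z \in s & forall x, x \in s -> (F x <= F z)%O.
Proof.
elim: s => // a [|b s] IH _.
  by exists a => [|x]; rewrite inE// => /eqP ->.
have [//|z zs Hz] := IH.
have [az|za] := leP (F a) (F z).
  by exists z => [|x]; rewrite inE ?zs ?orbT// => /predU1P[->//|/Hz].
exists a => [|x]; first by rewrite inE eqxx.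
rewrite inE => /predU1P[->//|/Hz xz]; exact: le_trans xz (ltW za).
Qed.

(* [wallis R m] is the integral of [(1 - x^2)^m] over [[0, 1]]. *)
Definition wallis (R : realFieldType) (m : nat) : R :=
  \prod_(i < m) ((2 * i%:R + 2) / (2 * i%:R + 3)).

Lemma wallisS (R : realFieldType) m :
  wallis R m.+1 = wallis R m * ((2 * m%:R + 2) / (2 * m%:R + 3)).
Proof. by rewrite /wallis big_ord_recr. Qed.

Lemma wallis_gt0 (R : realFieldType) m : 0 < wallis R m.
Proof.
apply: prodr_gt0 => i _; have := ler0n R i => i0.
by rewrite divr_gt0//; lra.
Qed.

Lemma ler_deriv_horner (R : realType) (p : {poly R}) (a b : R) :
  a <= b -> (forall x, a < x < b -> 0 <= p^`().[x]) -> p.[a] <= p.[b].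
Proof.
move=> ab H.
apply: (@ger0_derive1_le_cc R (horner p) a b); rewrite ?in_itv/= ?lexx ?ab//.
- by move=> x; rewrite in_itv/= -derivE; exact: H.
- apply: continuous_subspaceT; exact: continuous_horner.
Qed.

(* The right-hand side is the integral of [(L^2 - x^2)^(m+1)] over [[-L, L]].  The
   difference of the two sides for [m+1] has, up to a factor [2 L (m + 2)], the
   difference for [m] as derivative in [L].  Decreasing [L] until the term of the
   point [z] of [s] farthest from [mu] vanishes therefore allows one to drop [z]. *)
Lemma sum_parabola_exp_le (R : realType) (m : nat) (s : seq int) (mu L : R) :
  uniq s -> 0 <= L ->
  (forall z, z \in s -> (z%:~R - mu) ^+ 2 <= L ^+ 2 - 1 / 12) ->
  \sum_(z <- s) (L ^+ 2 - 1 / 12 - (z%:~R - mu) ^+ 2) ^+ m.+1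
    <= 2 * wallis R m.+1 * L ^+ (2 * m.+1).+1.
Proof.
elim: m s L => [|m IHm] s L us L0 sL.
  rewrite wallisS /wallis big_ord0.
  under eq_bigr do rewrite expr1.
  rewrite sumrB big_const_seq count_predT iter_addr addr0.
  have := uniq_int_sum_sqr_dev mu us.
  rewrite -[_ *+ size s]mulr_natl; set n : R := (size s)%:R => Hd.
  have n0 : 0 <= n by rewrite ler0n.
  (* The shift [1 / 12] cancels the linear term of the deviation bound, so the claim becomes
     [n L^2 - n^3 / 12 <= 4 L^3 / 3], whose gap is [2 / 3] of this product. *)
  have : 0 <= (L - n / 2) ^+ 2 * (2 * L + n / 2).
    by rewrite mulr_ge0 ?sqr_ge0//; lra.
  have -> : L ^+ (2 * 1).+1 = L ^+ 3 by [].
  rewrite mulr0 !add0r mul1r; move: Hd; set S := \sum_(i <- s) _.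
  lra.
have [k] := ubnP (size s); elim: k s us L L0 sL => // k IHk s us L L0 sL ks.
have [->|s0] := eqVneq s [::].
  have := wallis_gt0 R m.+2 => /ltW w0.
  by rewrite big_nil mulr_ge0 ?exprn_ge0// mulr_ge0.
have [z zs zmax] := seq_argmax (fun x => (x%:~R - mu) ^+ 2) s0.
pose c x : R := 1 / 12 + (x%:~R - mu) ^+ 2.
have [N NE] : {N | N = (2 * m.+1).+1} by exists (2 * m.+1).+1.
have NE2 : (2 * m.+2).+1 = N.+2 by rewrite NE; lia.
have NR : N%:R = 2 * m%:R + 3 :> R.
  by rewrite NE -(natr1 (2 * m.+1)) natrM -(natr1 m); ring.
move: IHm IHk; rewrite NE2 -NE => IHm IHk.
pose p : {poly R} := (2 * wallis R m.+2) *: 'X^(N.+2)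
  - \sum_(x <- s) ('X^2 - (c x)%:P) ^+ m.+2.
have pE x : p.[x] = 2 * wallis R m.+2 * x ^+ N.+2 -
     \sum_(y <- s) (x ^+ 2 - 1 / 12 - (y%:~R - mu) ^+ 2) ^+ m.+2.
  rewrite /p hornerD hornerN hornerZ hornerXn horner_sum; congr (_ - _).
  apply: eq_bigr => y _.
  by rewrite horner_exp hornerD hornerN hornerXn hornerC /c opprD addrA.
have p'E x : p^`().[x] = 2 * x * m.+2%:R * (2 * wallis R m.+1 * x ^+ N
   - \sum_(y <- s) (x ^+ 2 - 1 / 12 - (y%:~R - mu) ^+ 2) ^+ m.+1).
  rewrite /p derivB derivZ derivXn raddf_sum hornerD hornerN hornerZ hornerMn.
  rewrite hornerXn horner_sum mulrBr mulr_sumr; congr (_ - _).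
    rewrite wallisS -(mulr_natr _ N.+2) -(natr1 N.+1) -(natr1 N).
    rewrite -(natr1 m.+1) -(natr1 m) NR /= exprS.
    by field; have := ler0n R m; lra.
  apply: eq_bigr => y _.
  rewrite /= deriv_exp hornerMn derivB derivXn derivC subr0 !(hornerM, horner_exp).
  rewrite hornerMn hornerD hornerN hornerXn hornerC /c opprD addrA /= expr1.
  rewrite -(mulr_natr _ m.+2) -(mulr_natr _ 2) hornerXn.
  by rewrite (mulrC x) mulrAC.
rewrite -subr_ge0 -pE.
pose L0' := Num.sqrt (c z).
have cz0 : 0 <= c z by rewrite /c addr_ge0// ?sqr_ge0// divr_ge0.
have L0'2 : L0' ^+ 2 = c z by rewrite sqr_sqrtr.
have L0'0 : 0 <= L0' by rewrite sqrtr_ge0.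
have L0'L : L0' <= L.
  by rewrite -ler_sqr ?nnegrE// L0'2; have := sL _ zs; rewrite /c; lra.
apply: (@le_trans _ _ p.[L0']); last first.
  apply: ler_deriv_horner => // x /andP[xL0 xL].
  have x0 : 0 <= x by apply: le_trans (ltW xL0).
  rewrite p'E mulr_ge0// ?mulr_ge0// subr_ge0; apply: IHm => // y ys.
  have : L0' ^+ 2 <= x ^+ 2 by rewrite ler_sqr ?nnegrE// ltW.
  by rewrite L0'2 /c; have := zmax _ ys; lra.
rewrite pE subr_ge0 (perm_big _ (perm_to_rem zs))/= big_cons.
have -> : L0' ^+ 2 - 1 / 12 - (z%:~R - mu) ^+ 2 = 0 by rewrite L0'2 /c; ring.
rewrite expr0n add0r; apply: IHk => //.
- exact: rem_uniq.
- by move=> y /mem_rem ys; rewrite L0'2 /c; have := zmax _ ys; lra.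
- by rewrite size_rem//; case: (s) s0 ks => //= a t _; rewrite !ltnS.
Qed.

(** Concavity of [x^t]: after scaling by [l] this is Young's inequality for [y^t] and [1] with the
    exponents [1 / t] and [1 / (1 - t)]. *)
Lemma powR_le_tangent (R : realType) (x l t : R) :
  0 <= x -> 0 < l -> 0 <= t <= 1 -> x `^ t <= l `^ t * (1 - t + t * (x / l)).
Proof.
move=> x0 l0 /andP[t0 t1].
have lt0 : 0 < l `^ t by exact: powR_gt0.
have -> : x `^ t = l `^ t * (x / l) `^ t.
  by rewrite -powRM ?divr_ge0 ?(ltW l0)// mulrC divfK// gt_eqF.
rewrite ler_pM2l//.
have y0 : 0 <= x / l by rewrite divr_ge0// ltW.
move: (x / l) y0 => {x0 lt0 l0}y y0.
have [->|tn0] := eqVneq t 0; first by rewrite powRr0; lra.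
have [->|tn1] := eqVneq t 1; first by rewrite powRr1//; lra.
have {tn0}t0 : 0 < t by rewrite lt_neqAle eq_sym tn0.
have {tn1}t1 : t < 1 by rewrite lt_neqAle tn1.
have := @conjugate_powR R (y `^ t) 1 t^-1 (1 - t)^-1.
rewrite mulr1 powR_ge0 ler01 !invr_gt0 t0 subr_gt0 t1 !invrK subrKC.
move=> /(_ isT isT isT isT erefl) /le_trans; apply.
by rewrite -powRrM divff ?gt_eqF// powRr1// powR1; lra.
Qed.

(** By [wallisS], the quotient of two consecutive values of [wallis]. *)
Definition wallis_ratio (R : realFieldType) (m : nat) : R :=
  (2 * m%:R + 2) / (2 * m%:R + 3).

Lemma wallis_ratio_gt0 (R : realFieldType) m : 0 < wallis_ratio R m.
Proof. by have := ler0n R m => m0; rewrite divr_gt0//; lra. Qed.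

(* Interpolates between the exponents [m+1] and [m+2]; the tangent point is the ratio
   of the two bounds, so nothing is lost against the geometric mean of these. *)
Lemma sum_parabola_powR_le (R : realType) (m : nat) (t : R) (s : seq int)
    (mu L : R) :
  uniq s -> 0 < L -> 0 <= t <= 1 ->
  (forall z, z \in s -> (z%:~R - mu) ^+ 2 <= L ^+ 2 - 1 / 12) ->
  \sum_(z <- s) (L ^+ 2 - 1 / 12 - (z%:~R - mu) ^+ 2) `^ (m.+1%:R + t)
    <= (wallis_ratio R m.+1 * L ^+ 2) `^ t
       * (2 * wallis R m.+1 * L ^+ (2 * m.+1).+1).
Proof.
move=> us L0 t01 sL; have /andP[t0 t1] := t01.
set l := wallis_ratio R m.+1 * L ^+ 2.
have l0 : 0 < l by rewrite mulr_gt0 ?exprn_gt0 ?wallis_ratio_gt0.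
have A1 := sum_parabola_exp_le m us (ltW L0) sL.
have A2 := sum_parabola_exp_le m.+1 us (ltW L0) sL.
pose u (z : int) := L ^+ 2 - 1 / 12 - (z%:~R - mu) ^+ 2.
apply: (@le_trans _ _ (\sum_(z <- s)
    l `^ t * ((1 - t) * u z ^+ m.+1 + t / l * u z ^+ m.+2))).
  rewrite !big_seq; apply: ler_sum => z zs; rewrite -/(u z).
  have u0 : 0 <= u z by rewrite /u subr_ge0 sL.
  have [->|un0] := eqVneq (u z) 0.
    rewrite powR0 ?expr0n/= ?mulr0 ?addr0 ?mulr0//.
    by rewrite gt_eqF// ltr_wpDr// ltr0n.
  rewrite powRD; last by rewrite un0 implybT.
  rewrite powR_mulrn//.
  apply: le_trans (ler_wpM2l _ (powR_le_tangent u0 l0 t01)) _.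
    by rewrite exprn_ge0.
  by rewrite [u z ^+ m.+2]exprSr le_eqVlt; apply/orP; left; apply/eqP; ring.
rewrite -mulr_sumr ler_wpM2l ?powR_ge0// big_split/= -!mulr_sumr.
have w0 := wallis_gt0 R m.+1.
apply: (@le_trans _ _ ((1 - t) * (2 * wallis R m.+1 * L ^+ (2 * m.+1).+1) +
    t / l * (2 * wallis R m.+2 * L ^+ (2 * m.+2).+1))).
  by apply: lerD; apply: ler_wpM2l => //; rewrite ?subr_ge0 ?divr_ge0// ltW.
have -> : (2 * m.+2).+1 = ((2 * m.+1).+1 + 2)%N by lia.
rewrite exprD (wallisS R m.+1) -/(wallis_ratio R m.+1) /l.
rewrite le_eqVlt; apply/orP; left; apply/eqP; field.
by rewrite !gt_eqF ?wallis_ratio_gt0.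
Qed.

(** The induction step needs [((2 m + 2) / (2 m + 3))^2 <= (5 m + 4) / (5 m + 9)], an equality at
    [m = 0]; this fixes the constants. *)
Lemma wallis_sqr_le (R : realFieldType) m : wallis R m ^+ 2 <= 4 / (5 * m%:R + 4).
Proof.
have pos k : 0 < 5 * k%:R + 4 :> R by have := ler0n R k; lra.
elim: m => [|m IH]; first by rewrite /wallis big_ord0 expr1n mulr0 add0r divff.
rewrite wallisS exprMn.
have m0 := ler0n R m.
have := ler_wpM2r (sqr_ge0 ((2 * m%:R + 2) / (2 * m%:R + 3))) IH.
move=> /le_trans; apply.
rewrite expr_div_n mulrACA -invfM ler_pdivrMr; last first.
  by rewrite mulr_gt0// ?exprn_gt0//; lra.
rewrite mulrAC ler_pdivlMr ?pos// -(natr1 m); nra.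
Qed.

(** The twelfth power of [11 / 12 <= exp (- 1 / 12)] gives [e <= (12 / 11)^12], which is slightly
    below [57 / 20]. *)
Lemma expR1_le (R : realType) : expR 1 <= 57 / 20 :> R.
Proof.
have h : 11 / 12 <= expR (- (1 / 12)) :> R.
  by apply: le_trans (expR_ge1Dx _); lra.
have : (11 / 12) ^+ 12 <= (expR (- (1 / 12)) : R) ^+ 12.
  by rewrite lerXn2r ?nnegrE ?expR_ge0.
rewrite -expRM_natl.
have -> : 12%:R * - (1 / 12) = -1 :> R by field.
rewrite expRN => H.
have e0 : 0 < expR 1 :> R by exact: expR_gt0.
rewrite -(invrK (expR 1)) -[leRHS]invrK lef_pV2 ?posrE ?invr_gt0//.
by apply: le_trans H; lra.
Qed.

Lemma powR_le_expR (R : realType) (y k : R) :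
  0 < y -> 0 <= k -> y `^ k <= expR (k * (y - 1)).
Proof.
move=> y0 k0; rewrite /powR gt_eqF// ler_expR ler_wpM2l//.
by have := @le_ln1Dx R (y - 1); rewrite subrKC; apply; lra.
Qed.

(* Both sides equal 1 at [tau = 1], hence the separate, sharper treatment of [m = 0]. *)
Lemma wallis_entropy_le (R : realType) (m : nat) (t tau : R) :
  0 <= t <= 1 -> tau = m.+1%:R + t ->
  wallis R m.+1 ^+ 2 * (wallis_ratio R m.+1 ^+ 2) `^ t
    * ((2 * tau + 1) / (2 * tau)) `^ (2 * tau) <= 9 / (2 * tau + 7).
Proof.
move=> /andP[t0 t1]; case: m => [|m] tauE.
  have tau0 : 0 < tau by rewrite tauE; lra.
  (* Splitting off the value [3 / 2] at [tau = 1] leaves a factor equal to 1 there, so the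
     exponential bound is sharp at [t = 0]. *)
  have -> : (2 * tau + 1) / (2 * tau) = 3 / 2 * ((2 * tau + 1) / (3 * tau)).
    by field; rewrite gt_eqF.
  rewrite (@powRM _ (3 / 2) _ (2 * tau)) ?divr_ge0//; try lra.
  have := @powR_le_expR _ ((2 * tau + 1) / (3 * tau)) (2 * tau).
  have -> : 2 * tau * ((2 * tau + 1) / (3 * tau) - 1) = - (2 * t / 3).
    by rewrite tauE; field; lra.
  move=> /(_ _ _)/wrap[]; [by rewrite divr_gt0//; lra|by lra|].
  set E := _ `^ (2 * tau) => HE.
  have -> : (3 / 2) `^ (2 * tau) = 9 / 4 * (9 / 4) `^ t :> R.
    rewrite powRrM powR_mulrn; last by lra.
    have -> : (3 / 2) ^+ 2 = 9 / 4 :> R by field.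
    rewrite tauE powRD; last by apply/implyP => _; lra.
    by rewrite powRr1//; lra.
  have -> : wallis R 1 = 2 / 3.
    by rewrite wallisS /wallis big_ord0 mulr0 !add0r mul1r.
  have -> : wallis_ratio R 1 ^+ 2 = 16 / 25 by rewrite /wallis_ratio; field.
  have -> : (2 / 3) ^+ 2 * (16 / 25) `^ t * (9 / 4 * (9 / 4) `^ t * E) =
     (36 / 25) `^ t * E :> R.
    have -> : 36 / 25 = (16 / 25) * (9 / 4) :> R by field.
    rewrite (@powRM _ (16 / 25) (9 / 4) t); [by field|lra..].
  have t3 : 0 < (1 + t / 3) ^+ 2 by rewrite exprn_gt0//; lra.
  have {}HE : E <= ((1 + t / 3) ^+ 2)^-1.
    apply: le_trans HE _; rewrite expRN lef_pV2 ?posrE ?expR_gt0//.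
    have -> : 2 * t / 3 = 2%:R * (t / 3) by ring.
    rewrite expRM_natl lerXn2r ?nnegrE ?expR_ge0 ?expR_ge1Dx//; lra.
  have := @powR_le_tangent R (36 / 25) 1 t _ ltr01.
  rewrite powR1 mul1r t0 t1 => /(_ _ isT)/wrap[]; first lra.
  move=> Hp.
  apply: (@le_trans _ _ ((1 - t + t * (36 / 25 / 1)) / (1 + t / 3) ^+ 2)).
    by apply: ler_pM => //; rewrite powR_ge0.
  rewrite ler_pdivrMr// [leRHS]mulrAC ler_pdivlMr; last by rewrite tauE; lra.
  rewrite tauE; nra.
(* From [tau >= 2] on there is slack: the last power is at most [e <= 57 / 20], and the Wallis
   factors are bounded by rational functions of [k]. *)
have tau2 : 2 <= tau by rewrite tauE -(natr1 m.+1) -(natr1 m); have := ler0n R m; lra.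
have := @powR_le_expR _ ((2 * tau + 1) / (2 * tau)) (2 * tau).
have -> : 2 * tau * ((2 * tau + 1) / (2 * tau) - 1) = 1 by field; lra.
move=> /(_ _ _)/wrap[]; [by rewrite divr_gt0//; lra|by lra|] => HE.
have {HE} := le_trans HE (expR1_le R); set E := _ `^ (2 * tau) => HE.
have Hw := wallis_sqr_le R m.+2.
set k : R := m.+2%:R in Hw tauE.
have k2 : 2 <= k by rewrite /k -(natr1 m.+1) -(natr1 m); have := ler0n R m; lra.
have r2 : wallis_ratio R m.+2 ^+ 2 <= (5 * k + 4) / (5 * k + 9).
  rewrite /wallis_ratio -/k expr_div_n ler_pdivrMr; last by rewrite exprn_gt0//; lra.
  by rewrite [leRHS]mulrAC ler_pdivlMr; [nra|lra].
have Hr : (wallis_ratio R m.+2 ^+ 2) `^ t <= 1 - t + t * ((5 * k + 4) / (5 * k + 9)).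
  have := @powR_le_tangent R _ 1 t (sqr_ge0 (wallis_ratio R m.+2)) ltr01.
  rewrite powR1 mul1r divr1 t0 t1 => /(_ isT)/le_trans; apply.
  by rewrite lerD2l ler_wpM2l.
apply: (@le_trans _ _ (4 / (5 * k + 4) * (1 - t + t * ((5 * k + 4) / (5 * k + 9)))
                         * (57 / 20))).
  apply: ler_pM => //; first exact: mulr_ge0 (sqr_ge0 _) (powR_ge0 _ _).
    exact: powR_ge0.
  by apply: ler_pM => //; rewrite ?sqr_ge0 ?powR_ge0.
have -> : 4 / (5 * k + 4) * (1 - t + t * ((5 * k + 4) / (5 * k + 9))) * (57 / 20)
   = (57 / 5 * (5 * k + 9 - 5 * t)) / ((5 * k + 4) * (5 * k + 9)).
  by field; lra.
rewrite ler_pdivrMr; last by rewrite mulr_gt0//; lra.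
rewrite [leRHS]mulrAC ler_pdivlMr; last lra.
rewrite tauE; nra.
Qed.

(** * Entropy power bounded above by the variance *)

(** Young's inequality termwise, after dividing [f] and [g] by the two factors on the right. Since
    [F] and [G] are only upper bounds, the sum may run over part of the support while [F] is the
    full power sum. *)
Lemma sum_hoelder_le (R : realType) (I : Type) (s : seq I) (f g : I -> R)
    (p q F G : R) :
  (forall i, 0 <= f i) -> (forall i, 0 <= g i) ->
  0 < p -> 0 < q -> p^-1 + q^-1 = 1 -> 0 < F -> 0 < G ->
  \sum_(i <- s) f i `^ p <= F -> \sum_(i <- s) g i `^ q <= G ->
  \sum_(i <- s) f i * g i <= F `^ p^-1 * G `^ q^-1.
Proof.
move=> f0 g0 p0 q0 pq F0 G0 fF gG.
have F'0 : 0 < F `^ p^-1 by exact: powR_gt0.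
have G'0 : 0 < G `^ q^-1 by exact: powR_gt0.
rewrite -[leRHS]mul1r -ler_pdivrMr ?mulr_gt0// mulr_suml.
apply: (@le_trans _ _ (\sum_(i <- s) (f i `^ p / F / p + g i `^ q / G / q))).
  apply: ler_sum => i _.
  have -> : f i * g i / (F `^ p^-1 * G `^ q^-1) =
      (f i / F `^ p^-1) * (g i / G `^ q^-1) by rewrite invfM mulrACA.
  apply: le_trans (conjugate_powR _ _ p0 q0 pq) _.
  - by rewrite divr_ge0// ltW.
  - by rewrite divr_ge0// ltW.
  rewrite !powRM ?invr_ge0 ?(ltW F'0) ?(ltW G'0)//.
  have aux x r : 0 < x -> 0 < r -> (x `^ r^-1)^-1 `^ r = x^-1.
    move=> x0 r0; rewrite -powRN -powRrM mulNr mulVf ?gt_eqF//.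
    by rewrite powR_inv1// ltW.
  by rewrite !aux.
rewrite big_split/= -!mulr_suml -pq.
by apply: lerD; rewrite ler_piMl ?invr_ge0 ?(ltW p0) ?(ltW q0)// ler_pdivrMr// mul1r.
Qed.

Lemma sum_powR_gt0 (R : realType) (I : eqType) (s : seq I) (p : I -> R) (a : R) :
  (forall i, 0 <= p i) -> 0 < \sum_(i <- s) p i -> 0 < \sum_(i <- s) p i `^ a.
Proof.
move=> p0 s0; rewrite lt_neqAle sumr_ge0 ?andbT; last by move=> *; exact: powR_ge0.
apply: contraTneq s0 => /esym/eqP.
rewrite psumr_eq0; last by move=> *; exact: powR_ge0.
move=> /allP H; rewrite big_seq big1 ?ltxx// => i /H/= /eqP.
exact: powR_eq0_eq0.
Qed.

Lemma ler_npowR (R : realType) (x y k : R) :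
  0 < x -> 0 <= k -> x <= y -> y `^ (- k) <= x `^ (- k).
Proof.
move=> x0 k0 xy; have y0 := lt_le_trans x0 xy.
by rewrite !powRN lef_pV2 ?posrE ?powR_gt0// ge0_ler_powR// nnegrE ltW.
Qed.

Section seq_variance.
Variables (R : realType) (s : seq int) (p : int -> R) (a : R).
Hypotheses (us : uniq s) (p0 : forall z, 0 <= p z).
Hypothesis p1 : \sum_(z <- s) p z = 1.
Hypothesis a1 : 1 < a.

Let tau := a / (a - 1).

Let a1' : 0 < a - 1. Proof. by rewrite subr_gt0. Qed.

Let tau1 : 1 < tau. Proof. by rewrite /tau ltr_pdivlMr; have := a1'; lra. Qed.

Let atau : a^-1 + tau^-1 = 1.
Proof. by rewrite /tau; have := a1' => ?; field; apply/andP; split; lra. Qed.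

Let G := \sum_(z <- s) p z `^ a.

Let G0 : 0 < G. Proof. by apply: sum_powR_gt0; rewrite ?p1. Qed.

Lemma seq_renyi_large (mu : R) (V := \sum_(z <- s) p z * (z%:~R - mu) ^+ 2) :
  2 <= 4 * (2 * tau + 1) * V ->
  G `^ (- (2 / (a - 1))) <= 1 + 4 * (2 * tau + 1) * V.
Proof.
move=> V2; have := tau1 => T1; have := a1' => A1.
have V0 : 0 <= V by apply: sumr_ge0 => z _; rewrite mulr_ge0 ?sqr_ge0.
(* A density proportional to [(L^2 - x^2)^(tau - 1)] on [[-L, L]] has variance [L^2 / (2 tau + 1)];
   [L] matches this to [V] plus the variance [1 / 12] of a uniform law on a unit interval. *)
pose sigma := V + 1 / 12.
have sigma0 : 0 < sigma by rewrite /sigma; lra.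
pose L := Num.sqrt ((2 * tau + 1) * sigma).
have L2 : L ^+ 2 = (2 * tau + 1) * sigma.
  by rewrite sqr_sqrtr// mulr_ge0// ?(ltW sigma0)//; lra.
have L0 : 0 < L by rewrite sqrtr_gt0 mulr_gt0//; lra.
pose u (z : int) := L ^+ 2 - 1 / 12 - (z%:~R - mu) ^+ 2.
pose s' := [seq z <- s | 0 <= u z].
have s'E z : z \in s' -> (z%:~R - mu) ^+ 2 <= L ^+ 2 - 1 / 12.
  by rewrite mem_filter /u => /andP[+ _]; lra.
pose k := Num.truncn tau.
have /andP[k1 k2] : k%:R <= tau < k.+1%:R by apply: truncn_itv; lra.
have k0 : (0 < k)%N by rewrite truncn_gt0 ltW.
have [m kE] : exists m, k = m.+1 by exists k.-1; rewrite prednK.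
have [t t01 tauE] : exists2 t, 0 <= t <= 1 & tau = m.+1%:R + t.
  exists (tau - m.+1%:R); last by rewrite subrKC.
  by rewrite -kE; move: k2; rewrite -natr1 => k2; apply/andP; split; lra.
have us' : uniq s' by exact: filter_uniq.
have HW := sum_parabola_powR_le m us' L0 t01 s'E.
rewrite -tauE in HW; set W := _ * (_ * _) in HW.
have W0 : 0 < W.
  have w0 := wallis_gt0 R m.+1; have r0 := wallis_ratio_gt0 R m.+1.
  apply: mulr_gt0; first by rewrite powR_gt0// mulr_gt0// exprn_gt0.
  by rewrite mulr_gt0 ?exprn_gt0// mulr_gt0.
pose v z := Num.max 0 (u z).
(* The full parabola has mean [L^2 - 1 / 12 - V = 2 tau sigma]; dropping the points where it is
   negative can only increase the sum. *)
have HA : 2 * tau * sigma <= \sum_(z <- s') p z * v z.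
  have -> : 2 * tau * sigma = \sum_(z <- s) p z * u z.
    transitivity (\sum_(z <- s) ((L ^+ 2 - 1 / 12) * p z
                                 - p z * (z%:~R - mu) ^+ 2)).
      by rewrite sumrB -mulr_sumr p1 L2 /sigma -/V; ring.
    by apply: eq_bigr => z _; rewrite /u; ring.
  rewrite big_filter [leRHS]big_mkcond/=; apply: ler_sum => z _.
  case: ifPn => uz; first by rewrite ler_wpM2l// /v le_max lexx orbT.
  by rewrite mulr_ge0_le0// ltW// ltNge.
have HG : \sum_(z <- s') p z `^ a <= G.
  rewrite big_filter [leLHS]big_mkcond/=; apply: ler_sum => z _.
  by case: ifP => // _; exact: powR_ge0.
have HW' : \sum_(z <- s') v z `^ tau <= W.
  apply: le_trans HW; rewrite le_eqVlt; apply/orP; left; apply/eqP.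
  rewrite !big_seq; apply: eq_bigr => z; rewrite mem_filter => /andP[uz _].
  by rewrite /v max_r.
have v0 z : 0 <= v z by rewrite /v le_max lexx.
have a0 : 0 < a by lra.
have tau0 : 0 < tau by lra.
have := sum_hoelder_le p0 v0 a0 tau0 atau G0 W0 HG HW'.
move=> /(le_trans HA) H.
have W't : 0 < W `^ tau^-1 by exact: powR_gt0.
have ts0 : 0 < 2 * tau * sigma by rewrite mulr_gt0// mulr_gt0.
have {}H : 2 * tau * sigma / W `^ tau^-1 <= G `^ a^-1 by rewrite ler_pdivrMr.
(* Since [2 tau / a = 2 / (a - 1)], the lower bound [H] on [G^(1/a)] becomes an upper bound on the
   entropy power. *)
have -> : G `^ (- (2 / (a - 1))) = (G `^ a^-1) `^ (- (2 * tau)).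
  by rewrite -powRrM; congr (_ `^ _); rewrite /tau; field; apply/andP; split; lra.
apply: le_trans (ler_npowR _ _ H) _; [exact: divr_gt0|lra|].
have -> : (2 * tau * sigma / W `^ tau^-1) `^ (- (2 * tau)) =
    W ^+ 2 / (2 * tau * sigma) `^ (2 * tau).
  rewrite powRN powRM ?invr_ge0 ?(ltW ts0) ?(ltW W't)// invfM mulrC; congr (_ * _).
  rewrite -(powRN _ tau^-1) -powRrM -powRN -powR_mulrn ?(ltW W0)//.
  by congr (_ `^ _); field; lra.
have -> : W ^+ 2 = 4 * (wallis R m.+1 ^+ 2 * (wallis_ratio R m.+1 ^+ 2) `^ t) *
    L ^+ 2 * (L ^+ 2) `^ (2 * tau).
  have powR_sqr x y : 0 <= x -> x `^ (y * 2) = (x `^ y) ^+ 2.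
    by move=> x0; rewrite powRrM powR_mulrn// powR_ge0.
  have sqr_powR x : 0 <= x -> (x ^+ 2) `^ t = (x `^ t) ^+ 2.
    by move=> x0; rewrite expr2 powRM.
  have -> : (L ^+ 2) `^ (2 * tau) = ((L ^+ 2) `^ t * L ^+ (2 * m.+1)) ^+ 2.
    rewrite mulrC powR_sqr ?sqr_ge0// [in LHS]tauE addrC.
    rewrite (@powRD _ (L ^+ 2)); last first.
      by apply/implyP => _; rewrite expf_neq0// gt_eqF.
    by rewrite powR_mulrn ?sqr_ge0// exprM.
  have r0 := ltW (wallis_ratio_gt0 R m.+1).
  rewrite (sqr_powR _ r0) /W powRM ?sqr_ge0// (exprS L (2 * m.+1)).
  set x := _ `^ t; set y := _ `^ t; set z := _ ^+ (2 * m.+1); set w := wallis _ _.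
  ring.
have := wallis_entropy_le t01 tauE; set Q := wallis R _ ^+ 2 * _ => HQ.
have eL : (2 * tau + 1) / (2 * tau) = L ^+ 2 / (2 * tau * sigma).
  by rewrite L2; field; apply/andP; split; lra.
rewrite [leLHS](_ : _ = 4 * ((2 * tau + 1) * sigma)
  * (Q * ((2 * tau + 1) / (2 * tau)) `^ (2 * tau))); last first.
  rewrite eL (@powRM _ (L ^+ 2) (2 * tau * sigma)^-1) ?sqr_ge0 ?invr_ge0 ?(ltW ts0)//.
  rewrite -(powR_inv1 (ltW ts0)) -powRrM mulN1r powRN -L2.
  set x := _ `^ (2 * tau); set y := _ `^ (2 * tau).
  ring.
apply: le_trans (ler_wpM2l _ HQ) _.
  by rewrite mulr_ge0// mulr_ge0 ?(ltW sigma0)//; lra.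
rewrite [leLHS]mulrA ler_pdivrMr; last lra.
rewrite /sigma.
(* Multiplied by [2 tau + 7], the remaining inequality says exactly this; the threshold 2 in the
   hypothesis comes from here. *)
have : 0 <= (tau - 1) * (2 * (4 * (2 * tau + 1) * V) - 4) by apply: mulr_ge0; lra.
lra.
Qed.

Lemma seq_renyi_small (mu := \sum_(z <- s) p z * z%:~R)
    (V := \sum_(z <- s) p z * (z%:~R - mu) ^+ 2) :
  4 * (2 * tau + 1) * V <= 2 ->
  G `^ (- (2 / (a - 1))) <= 1 + 4 * (2 * tau + 1) * V.
Proof.
move=> V2; have := tau1 => T1; have := a1' => A1.
have V0 : 0 <= V by apply: sumr_ge0 => z _; rewrite mulr_ge0 ?sqr_ge0.
pose b := Num.floor (mu + 1 / 2).
have /andP[b1 b2] : b%:~R <= mu + 1 / 2 < (b + 1)%:~R by exact: floor_itv.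
rewrite rmorphD/= in b2.
pose E := \sum_(z <- s) p z * (z%:~R - b%:~R) ^+ 2.
have VE : E = V + (mu - b%:~R) ^+ 2.
  rewrite /E /V.
  transitivity (\sum_(z <- s) (p z * (z%:~R - mu) ^+ 2
      + (2 * (mu - b%:~R) * (p z * z%:~R) + (b%:~R ^+ 2 - mu ^+ 2) * p z))).
    by apply: eq_bigr => z _; ring.
  by rewrite !big_split/= -!mulr_sumr p1 -/mu; ring.
(* Integers satisfy [|z - b| <= (z - b)^2], so [|mu - b| <= E]. As [b] is nearest to [mu], also
   [|mu - b| <= 1 / 2]; hence [(mu - b)^2 <= E / 2] and [E <= 2 V]. *)
have dE : `|mu - b%:~R| <= E.
  have -> : mu - b%:~R = \sum_(z <- s) p z * (z - b)%:~R.
    under eq_bigr do rewrite rmorphB/= mulrBr.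
    by rewrite sumrB -mulr_suml p1 mul1r.
  apply: le_trans (ler_norm_sum _ _ _) _; apply: ler_sum => z _.
  rewrite normrM ger0_norm// ler_wpM2l// -rmorphB/= -rmorphXn/= -intr_norm ler_int.
  by nia.
have d2 : `|mu - b%:~R| <= 1 / 2 by rewrite ler_norml; apply/andP; split; lra.
have EV : E <= 2 * V.
  have : (mu - b%:~R) ^+ 2 <= E / 2.
    rewrite -real_normK ?num_real// expr2.
    apply: le_trans (ler_pM (normr_ge0 _) (normr_ge0 _) dE d2) _; lra.
  lra.
have Eb : \sum_(z <- s | z != b) p z <= E.
  rewrite /E [leLHS]big_mkcond/=; apply: ler_sum => z _.
  case: ifPn => zb; last by rewrite mulr_ge0 ?sqr_ge0.
  rewrite ler_peMr// -rmorphB/= -rmorphXn/= ler1z.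
  by move: zb; nia.
have V12 : V < 1 / 2.
  rewrite ltNge; apply/negP => V12.
  have : 4 * (2 * tau + 1) * (1 / 2) <= 2.
    by apply: le_trans V2; rewrite ler_wpM2l//; lra.
  lra.
have bs : b \in s.
  apply/negPn/negP => bs.
  have : \sum_(z <- s | z != b) p z = 1.
    rewrite -p1 big_seq_cond [RHS]big_seq; apply: eq_bigl => z.
    by case: (boolP (z \in s)) => //= zs; apply: contraNneq bs => <-.
  lra.
have pb : 1 - 2 * V <= p b.
  have := p1; rewrite (bigD1_seq b)//=; lra.
have Gb : p b `^ a <= G.
  rewrite /G (bigD1_seq b)//= lerDl; apply: sumr_ge0 => z _; exact: powR_ge0.
have q0 : 0 < 1 - 2 * V by lra.
have qG : (1 - 2 * V) `^ a <= G.
  by apply: le_trans Gb; rewrite ge0_ler_powR ?nnegrE//; lra.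
have k0 : 0 <= 2 / (a - 1) by rewrite divr_ge0// ltW.
apply: le_trans (ler_npowR _ k0 qG) _; first exact: powR_gt0.
have -> : ((1 - 2 * V) `^ a) `^ (- (2 / (a - 1))) = (1 - 2 * V)^-1 `^ (2 * tau).
  rewrite -powRrM -(powR_inv1 (ltW q0)) -powRrM; congr (_ `^ _).
  by rewrite /tau; field; lra.
apply: le_trans (powR_le_expR _ _) _; [by rewrite invr_gt0|lra|].
set v := 2 * (2 * tau + 1) * V.
have v0 : 0 <= v by rewrite mulr_ge0//; lra.
have v1 : v <= 1 by rewrite /v; lra.
have kv : 2 * tau * ((1 - 2 * V)^-1 - 1) <= v.
  have -> : 2 * tau * ((1 - 2 * V)^-1 - 1) = (4 * tau * V) / (1 - 2 * V).
    by field; lra.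
  rewrite ler_pdivrMr// /v.
  have : 0 <= V * (1 - v) by apply: mulr_ge0; lra.
  rewrite /v; lra.
have -> : 4 * (2 * tau + 1) * V = 2 * v by rewrite /v; ring.
apply: (@le_trans _ _ (expR v)); first by rewrite ler_expR.
have -> : expR v = (expR 1) `^ v by rewrite -expRM mul1r.
(* For [v] in [[0, 1]] this is the chord bound [e^v <= 1 + (e - 1) v], and [e - 1 <= 2]. *)
have := @powR_le_tangent R (expR 1) 1 v (expR_ge0 _) ltr01.
rewrite v0 v1 powR1 mul1r divr1 => /(_ isT) /le_trans; apply.
have : v * expR 1 <= v * (57 / 20) by rewrite ler_wpM2l ?expR1_le.
lra.
Qed.
End seq_variance.

(** * Extended sums as suprema of finite sums *)

Local Open Scope ereal_scope.

Section esum_seq.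
Context {R : realType} {T : choiceType}.
Implicit Types (a : T -> \bar R) (s : seq T).

Lemma seq_le_esum a s : uniq s ->
  \sum_(x <- s) a x <= \esum_(x in [set: T]) a x.
Proof.
move=> us; apply: esum_ge; exists [set` s]%classic; last by rewrite -fsbig_seq.
by split; [exact: finite_seq|exact: subsetT].
Qed.

Lemma esum_le_seq a B :
  (forall s, uniq s -> \sum_(x <- s) a x <= B) ->
  \esum_(x in [set: T]) a x <= B.
Proof.
move=> H; apply: ge_ereal_sup => _ [X [fX _] <-].
by rewrite fsbig_finite//; apply: H; exact: finmap.fset_uniq.
Qed.

Lemma lt_esum_seq a B : B < \esum_(x in [set: T]) a x ->
  exists2 s, uniq s & B < \sum_(x <- s) a x.
Proof.
move=> /ereal_sup_gt[_ [X [fX _] <-]]; rewrite fsbig_finite// => H.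
by eexists; [|exact: H]; exact: finmap.fset_uniq.
Qed.

Lemma esumZl (c : R) a : (forall x, 0 <= a x) -> (0 <= c)%R ->
  \esum_(x in [set: T]) (c%:E * a x) = c%:E * \esum_(x in [set: T]) a x.
Proof.
move=> a0.
have H (k : R) b : (0 <= k)%R -> (forall x, 0 <= b x) ->
    \esum_(x in [set: T]) (k%:E * b x) <= k%:E * \esum_(x in [set: T]) b x.
  move=> k0 b0; apply: esum_le_seq => s us.
  by rewrite -ge0_sume_distrr// lee_wpmul2l ?lee_fin ?seq_le_esum.
rewrite le_eqVlt => /predU1P[<-|c0].
  by rewrite mul0e esum1// => x _; rewrite mul0e.
apply/eqP; rewrite eq_le H ?(ltW c0)//=.
have ca0 x : 0 <= c%:E * a x by rewrite mule_ge0// lee_fin ltW.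
have ci : (0 <= c^-1)%R by rewrite invr_ge0 ltW.
(* The reverse inequality is [H] for the factor [c^-1] and the scaled family. *)
have := H c^-1%R _ ci ca0.
under eq_esum do rewrite muleA -EFinM mulVf ?gt_eqF// mul1e.
move=> /(lee_wpmul2l (ltW c0 : 0 <= c%:E)).
by rewrite muleA -EFinM mulfV ?gt_eqF// mul1e.
Qed.

End esum_seq.
Local Close Scope ereal_scope.

(** The variance is rewritten through pairwise differences, which remain meaningful for infinite
    families without a finite mean; the constant comes from [2 tau + 1 = (3 a - 1) / (a - 1)]. *)
Lemma seq_renyi_le (R : realType) (s : seq int) (p : int -> R) (a : R) :
  uniq s -> (forall z, 0 <= p z) -> \sum_(z <- s) p z = 1 -> 1 < a ->
  (\sum_(z <- s) p z `^ a) `^ (- (2 / (a - 1))) <=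
  1 + 2 * ((3 * a - 1) / (a - 1)) *
      \sum_(i <- s) \sum_(j <- s) p i * p j * (i - j)%:~R ^+ 2.
Proof.
move=> us p0 p1 a1.
set mu := \sum_(z <- s) p z * z%:~R.
set V := \sum_(z <- s) p z * (z%:~R - mu) ^+ 2.
have -> : \sum_(i <- s) \sum_(j <- s) p i * p j * (i - j)%:~R ^+ 2 = 2 * V.
  transitivity (\sum_(i <- s) (p i * (i%:~R - mu) ^+ 2 + V * p i)).
    apply: eq_bigr => i _.
    transitivity (\sum_(j <- s) (p i * (i%:~R - mu) ^+ 2 * p j
      + (p i * (p j * (j%:~R - mu) ^+ 2)
      + - (2 * p i * (i%:~R - mu)) * (p j * j%:~R - mu * p j)))).
      by apply: eq_bigr => j _; rewrite rmorphB/=; ring.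
    by rewrite !big_split/= -!mulr_sumr sumrB -/V -/mu -mulr_sumr p1; ring.
  by rewrite big_split/= -mulr_sumr -/V p1; ring.
have a1' : 0 < a - 1 by rewrite subr_gt0.
have a0 : 0 < a by exact: lt_trans ltr01 a1.
have -> : 2 * ((3 * a - 1) / (a - 1)) * (2 * V) =
    4 * (2 * (a / (a - 1)) + 1) * V by field; lra.
have [H|/ltW H] := leP (4 * (2 * (a / (a - 1)) + 1) * V) 2.
- exact: seq_renyi_small.
- exact: seq_renyi_large.
Qed.

(** Bernoulli's inequality for real exponents: the tangent bound for the exponent [1 / k], raised to
    the power [k]. *)
Lemma powR_ge_bernoulli (R : realType) (m k : R) :
  0 < m <= 1 -> (1 : R) <= k -> 1 - k * (1 - m) <= m `^ k.
Proof.
move=> /andP[m0 m1] k1.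
have [H|H] := leP (1 - k * (1 - m)) 0; first exact: le_trans H (powR_ge0 _ _).
have k0 : 0 < k by lra.
have t01 : 0 <= k^-1 <= 1 by rewrite invr_ge0 (ltW k0) invf_le1.
have := powR_le_tangent (ltW H) ltr01 t01.
rewrite powR1 mul1r divr1.
have -> : 1 - k^-1 + k^-1 * (1 - k * (1 - m)) = m by field; lra.
move=> /(ge0_ler_powR (ltW k0)); rewrite !nnegrE powR_ge0 (ltW m0) -powRrM.
by rewrite mulVf ?gt_eqF// powRr1 ?(ltW H)//; exact.
Qed.

(** A finite part of a probability mass function has mass [m] possibly below one. Normalising it
    produces powers of [m] that combine to [m^(2 tau + 2)], which Bernoulli's inequality bounds
    below by a factor tending to 1 with [m]. *)
Lemma seq_renyi_le_mass (R : realType) (s : seq int) (p : int -> R) (a : R)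
    (m := \sum_(z <- s) p z) :
  uniq s -> (forall z, 0 <= p z) -> 0 < m <= 1 -> 1 < a ->
  (\sum_(z <- s) p z `^ a) `^ (- (2 / (a - 1))) *
    (1 - (2 * (a / (a - 1)) + 2) * (1 - m)) <=
  1 + 2 * ((3 * a - 1) / (a - 1)) *
      \sum_(i <- s) \sum_(j <- s) p i * p j * (i - j)%:~R ^+ 2.
Proof.
move=> us p0 /andP[m0 m1] a1; have a1' : 0 < a - 1 by rewrite subr_gt0.
have a0 : 0 < a by exact: lt_trans ltr01 a1.
set G := \sum_(z <- s) p z `^ a; set C := 2 * ((3 * a - 1) / (a - 1)).
set D := \sum_(i <- s) \sum_(j <- s) _.
have G0 : 0 <= G by apply: sumr_ge0 => *; exact: powR_ge0.
have g0 z : 0 <= p z / m by rewrite divr_ge0// ltW.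
have g1 : \sum_(z <- s) p z / m = 1 by rewrite -mulr_suml divff// gt_eqF.
have := seq_renyi_le us g0 g1 a1; rewrite -/C.
have -> : \sum_(z <- s) (p z / m) `^ a = G * m^-1 `^ a.
  by rewrite mulr_suml; apply: eq_bigr => z _; rewrite powRM// invr_ge0 ltW.
have -> : \sum_(i <- s) \sum_(j <- s) p i / m * (p j / m) * (i - j)%:~R ^+ 2
    = D / m ^+ 2.
  rewrite mulr_suml; apply: eq_bigr => i _; rewrite mulr_suml.
  by apply: eq_bigr => j _; field; rewrite gt_eqF.
have -> : (G * m^-1 `^ a) `^ (- (2 / (a - 1))) =
    G `^ (- (2 / (a - 1))) * m `^ (2 * (a / (a - 1))).
  rewrite powRM ?powR_ge0//; congr (_ * _).
  rewrite -(powR_inv1 (ltW m0)) -!powRrM; congr (_ `^ _).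
  by field; lra.
set k := 2 * (a / (a - 1)) => H.
have k0 : 0 <= k by rewrite mulr_ge0// divr_ge0 ?(ltW a1')//; lra.
apply: (@le_trans _ _ (G `^ (- (2 / (a - 1))) * m `^ (k + 2))).
  rewrite ler_wpM2l ?powR_ge0//; apply: powR_ge_bernoulli; last lra.
  by rewrite m0.
rewrite powRD; last by rewrite (gt_eqF m0) implybT.
rewrite mulrA (powR_mulrn 2) ?(ltW m0)//.
apply: le_trans (ler_wpM2r (sqr_ge0 m) H) _.
have -> : (1 + C * (D / m ^+ 2)) * m ^+ 2 = m ^+ 2 + C * D by field; rewrite gt_eqF.
by rewrite lerD2r expr_le1// ltW.
Qed.

Local Open Scope ereal_scope.

Lemma esum_renyi_le (R : realType) (p : int -> R) (a : R) :
  (forall z, 0 <= p z)%R -> \esum_(z in [set: int]) (p z)%:E = 1 -> (1 < a)%R ->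
  (\esum_(z in [set: int]) (p z `^ a)%:E) `^ (- 2 / (a - 1)) - 1 <=
  (2 * ((3 * a - 1) / (a - 1)))%:E *
    \esum_(i in [set: int]) \esum_(j in [set: int])
      (p i * p j * (i - j)%:~R ^+ 2)%:E.
Proof.
move=> p0 p1 a1; have a1' : (0 < a - 1)%R by rewrite subr_gt0.
have a0 : (0 < a)%R by exact: lt_trans ltr01 a1.
set G := \esum_(z in _) _; set D := \esum_(i in _) _.
set C : R := (2 * ((3 * a - 1) / (a - 1)))%R.
have C0 : (0 < C)%R by rewrite mulr_gt0// divr_gt0//; lra.
have D0 : 0 <= D.
  rewrite /D; apply: esum_ge0 => i _ /=; apply: esum_ge0 => j _ /=.
  by rewrite lee_fin mulr_ge0 ?sqr_ge0// mulr_ge0.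
have pe0 z : 0 <= (p z)%:E by rewrite lee_fin.
have s1 s : uniq s -> (\sum_(z <- s) p z <= 1)%R.
  by move=> us; rewrite -lee_fin -sumEFin -p1; exact: seq_le_esum.
have ple1 z : (p z <= 1)%R by have := s1 [:: z] isT; rewrite big_seq1.
have Gle1 : G <= 1.
  rewrite -p1; apply: le_esum => z _; rewrite lee_fin.
  have [->|pz] := eqVneq (p z) 0%R; first by rewrite powR0// gt_eqF//; lra.
  rewrite -[leRHS]powRr1//; apply: ger_powR; last exact: ltW.
  by rewrite ple1 andbT lt_neqAle eq_sym pz p0.
have G0 : 0 <= G by apply: esum_ge0 => z _; rewrite lee_fin powR_ge0.
have : G \is a fin_num.
  by rewrite ge0_fin_numE//; apply: le_lt_trans Gle1 _; rewrite ltry.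
have Gs s : uniq s -> (\sum_(z <- s) p z `^ a)%:E <= G.
  by move=> us; rewrite -sumEFin; exact: seq_le_esum.
have Ds s : uniq s ->
    (\sum_(i <- s) \sum_(j <- s) p i * p j * (i - j)%:~R ^+ 2)%:E <= D.
  move=> us; rewrite -sumEFin; apply: le_trans (seq_le_esum _ us).
  by apply: lee_sum => i _; rewrite -sumEFin; exact: seq_le_esum.
move: G Gle1 G0 Gs => [g||]// _ g0 Gs _.
move: D D0 Ds => [dd||]// D0 Ds; last by rewrite gt0_muley ?leey// lte_fin.
rewrite poweR_EFin -EFinM -EFinB lee_fin lerBlDl mulNr.
rewrite !lee_fin in g0 D0.
have ne s : uniq s -> (0 < \sum_(z <- s) p z)%R ->
    (g `^ (- (2 / (a - 1))) * (1 - (2 * (a / (a - 1)) + 2) * (1 - \sum_(z <- s) p z))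
     <= 1 + C * dd)%R.
  move=> us m0.
  have := @seq_renyi_le_mass R s p a us p0 _ a1; rewrite m0 s1// => /(_ isT) H.
  have Cd : (0 <= 1 + C * dd)%R by rewrite addr_ge0// mulr_ge0// ltW.
  set X := (1 - _)%R in H *.
  have [X0|X0] := leP X 0%R.
    by apply: le_trans Cd; rewrite mulr_ge0_le0// powR_ge0.
  apply: (@le_trans _ _ ((\sum_(z <- s) p z `^ a) `^ (- (2 / (a - 1))) * X)%R).
    rewrite ler_wpM2r ?(ltW X0)//; apply: ler_npowR.
    - exact: sum_powR_gt0.
    - by rewrite divr_ge0// ltW.
    - by rewrite -lee_fin Gs.
  apply: le_trans H _; rewrite lerD2l ler_wpM2l ?(ltW C0)//.
  by rewrite -lee_fin Ds.
set N := (g `^ _)%R in ne *; set K := (1 + C * dd)%R in ne *.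
have N0 : (0 <= N)%R by exact: powR_ge0.
set k := (_ + 2)%R in ne.
have k0 : (0 < k)%R by rewrite /k ltr_wpDl// mulr_ge0// divr_ge0 ?(ltW a1')//; lra.
apply/ler_addgt0Pr => e e0.
(* A mass deficit below [del] costs at most [N k del <= e]; the cap [1 / 2] keeps the captured mass
   positive, and the [+ 1] the denominator. *)
pose del := Num.min (1 / 2)%R (e / (N * k + 1))%R.
have Nk : (0 <= N * k)%R by rewrite mulr_ge0// ltW.
have del0 : (0 < del)%R.
  by rewrite /del lt_min divr_gt0//= divr_gt0//; lra.
have [s us] : exists2 s, uniq s & (1 - del)%:E < \sum_(z <- s) (p z)%:E.
  by apply: lt_esum_seq; rewrite p1 lte_fin; lra.
rewrite sumEFin lte_fin => sd.
have del2 : (del <= 1 / 2)%R by rewrite /del ge_min lexx.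
have dele : (del * (N * k + 1) <= e)%R.
  by rewrite -ler_pdivlMr ?ge_min ?lexx ?orbT//; lra.
have H := ne s us ltac:(lra).
have : (N * k * (1 - \sum_(z <- s) p z) <= N * k * del)%R by rewrite ler_wpM2l//; lra.
have := s1 s us; move: H sd.
set m := (\sum_(z <- s) p z)%R; nra.
Qed.

Local Close Scope ereal_scope.

(** * Sums over the integers, convolution and log-concavity *)

Local Open Scope ereal_scope.

Section esum_more.
Context {R : realType}.

Lemma esum_mule (T : choiceType) (c : \bar R) (a : T -> \bar R) :
  (forall x, 0 <= a x) -> 0 <= c ->
  \esum_(x in [set: T]) (c * a x) = c * \esum_(x in [set: T]) a x.
Proof.
move=> a0; case: c => [c||//] c0; first exact: esumZl.
(* For infinite [c], either every term vanishes and [+oo * 0 = 0], or one positive term makes both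
   sides infinite. *)
have [a_eq0|/existsNP[x /eqP ax]] := pselect (forall x, a x = 0).
  by rewrite !esum1 ?mule0// => x _; rewrite a_eq0 mule0.
have {}ax : 0 < a x by rewrite lt_neqAle eq_sym ax a0.
have lex (b : T -> \bar R) : b x <= \esum_(y in [set: T]) b y.
  by have := @seq_le_esum R T b [:: x] isT; rewrite big_seq1.
rewrite gt0_mulye; last exact: lt_le_trans ax (lex a).
by apply/eqP; rewrite -leye_eq; apply: le_trans (lex _); rewrite gt0_mulye.
Qed.

Lemma esum_swap (T T' : choiceType) (a : T -> T' -> \bar R) :
  (forall i j, 0 <= a i j) ->
  \esum_(i in [set: T]) \esum_(j in [set: T']) a i j =
  \esum_(j in [set: T']) \esum_(i in [set: T]) a i j.
Proof.
move=> a0; rewrite !esum_esum//.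
rewrite (reindex_esum ([set: T'] `*`` (fun=> [set: T]))%classic _ (fun x => (x.2, x.1)))//.
split => //=; first by move=> [i j] [i' j'] _ _ [-> ->].
by move=> [i j] _ /=; exists (j, i).
Qed.

Lemma esum_shift (c : int) (a : int -> \bar R) :
  \esum_(i in [set: int]) a i = \esum_(i in [set: int]) a (i + c)%R.
Proof.
apply: reindex_esum; split => //; first by move=> i j _ _ /addIr.
by move=> i _; exists (i - c)%R => //; rewrite subrK.
Qed.

Lemma esum_opp (a : int -> \bar R) :
  \esum_(i in [set: int]) a i = \esum_(i in [set: int]) a (- i)%R.
Proof.
by apply: reindex_esum; split.
Qed.

End esum_more.

(** The expectation of [phi] under [p], with extended values so that no integrability has to be
    tracked. *)
Definition psum (R : realType) (p : int -> R) (phi : int -> \bar R) : \bar R :=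
  \esum_(i in [set: int]) ((p i)%:E * phi i).

Definition is_conv (R : realType) (p q h : int -> R) : Prop :=
  forall n, (h n)%:E = \esum_(i in [set: int]) (p i * q (n - i))%:E.

(** Here [x] and [y] lie between [u] and [v]. This single inequality combines the local condition
    with the absence of gaps in the support, and it passes to convolutions. *)
Definition log_concave_seq (R : realType) (f : int -> R) : Prop :=
  forall u x y v : int, (u <= x -> u <= y -> u + v = x + y ->
    f u * f v <= f x * f y)%R.

Section psum.
Context {R : realType}.
Implicit Types (p q h : int -> R) (phi psi : int -> \bar R).

Lemma psum_ge0 p phi : (forall i, 0 <= p i)%R -> (forall i, 0 <= phi i) ->
  0 <= psum p phi.
Proof. by move=> p0 f0; apply: esum_ge0 => i _; rewrite mule_ge0// lee_fin. Qed.

Lemma eq_psum p phi psi : phi =1 psi -> psum p phi = psum p psi.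
Proof. by move=> e; apply: eq_esum => i _; rewrite e. Qed.

Lemma psumD p phi psi : (forall i, 0 <= p i)%R ->
  (forall i, 0 <= phi i) -> (forall i, 0 <= psi i) ->
  psum p (fun i => phi i + psi i) = psum p phi + psum p psi.
Proof.
move=> p0 f0 g0; rewrite /psum -esumD; last 2 first.
- by move=> i _; rewrite mule_ge0// lee_fin.
- by move=> i _; rewrite mule_ge0// lee_fin.
by apply: eq_esum => i _; rewrite ge0_muleDr.
Qed.

Lemma psum_cst p (c : \bar R) : (forall i, 0 <= p i)%R ->
  psum p (fun=> 1) = 1 -> 0 <= c -> psum p (fun=> c) = c.
Proof.
move=> p0 p1 c0; rewrite /psum; under eq_esum do rewrite muleC.
rewrite esum_mule//.
by rewrite -[RHS]mule1 -p1; congr (_ * _); apply: eq_esum => i _; rewrite mule1.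
Qed.

Lemma psumD_eq p chi phi psi : (forall i, 0 <= p i)%R ->
  (forall i, 0 <= phi i) -> (forall i, 0 <= psi i) ->
  (forall i, chi i = phi i + psi i) -> psum p chi = psum p phi + psum p psi.
Proof. by move=> p0 f0 g0 e; rewrite -psumD//; apply: eq_psum. Qed.

Lemma psum_cstD p (c : \bar R) phi : (forall i, 0 <= p i)%R ->
  psum p (fun=> 1) = 1 -> 0 <= c -> (forall i, 0 <= phi i) ->
  psum p (fun i => c + phi i) = c + psum p phi.
Proof. by move=> p0 p1 c0 f0; rewrite psumD// psum_cst. Qed.

Lemma psum_swap p q (phi : int -> int -> \bar R) :
  (forall i, 0 <= p i)%R -> (forall i, 0 <= q i)%R -> (forall i j, 0 <= phi i j) ->
  psum p (fun i => psum q (phi i)) = psum q (fun j => psum p (phi ^~ j)).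
Proof.
move=> p0 q0 f0; rewrite /psum.
transitivity (\esum_(i in [set: int]) \esum_(j in [set: int])
    ((p i)%:E * ((q j)%:E * phi i j))).
  by apply: eq_esum => i _; rewrite -esum_mule ?lee_fin// => j; rewrite mule_ge0// lee_fin.
rewrite esum_swap; last by move=> i j; rewrite !mule_ge0 ?lee_fin.
apply: eq_esum => j _; rewrite -esum_mule ?lee_fin//.
- by apply: eq_esum => i _; rewrite muleCA.
- by move=> i; rewrite mule_ge0// lee_fin.
Qed.

(** The expectation at a sum of independent variables is an iterated expectation: Tonelli, then the
    substitution [n = i + j]. *)
Lemma conv_psum p q h phi : (forall i, 0 <= p i)%R -> (forall i, 0 <= q i)%R ->
  (forall i, 0 <= phi i) -> is_conv p q h ->
  psum h phi = psum p (fun a => psum q (fun b => phi (a + b)%R)).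
Proof.
move=> p0 q0 f0 hE; rewrite /psum.
transitivity (\esum_(n in [set: int]) \esum_(i in [set: int])
    (phi n * (p i * q (n - i))%:E)).
  apply: eq_esum => n _; rewrite hE muleC -esum_mule// => i.
  by rewrite lee_fin mulr_ge0.
rewrite esum_swap; last by move=> i j; rewrite mule_ge0// lee_fin mulr_ge0.
apply: eq_esum => i _; rewrite -esum_mule ?lee_fin//; last first.
  by move=> j; rewrite mule_ge0// lee_fin.
rewrite (esum_shift i); apply: eq_esum => j _.
by rewrite addrK EFinM muleC muleA (addrC i).
Qed.

(* Twice the variance of [p], without reference to a possibly infinite mean. *)
Definition sqdist p : \bar R :=
  psum p (fun i => psum p (fun j => (((i - j)%:~R : R) ^+ 2)%:E)).

Lemma sqdistE p : (forall i, 0 <= p i)%R ->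
  sqdist p = \esum_(i in [set: int]) \esum_(j in [set: int])
    (p i * p j * (i - j)%:~R ^+ 2)%:E.
Proof.
move=> p0; apply: eq_esum => i _.
rewrite -esum_mule ?lee_fin//; last first.
  by move=> j; rewrite mule_ge0// lee_fin ?sqr_ge0.
by apply: eq_esum => j _; rewrite -!EFinM mulrA.
Qed.

Lemma sqdist_ge0 p : (forall i, 0 <= p i)%R -> 0 <= sqdist p.
Proof. by move=> p0; do 2!(apply: psum_ge0 => // ?); rewrite lee_fin sqr_ge0. Qed.

(* [(x + y)^2 + (x - y)^2 = 2 x^2 + 2 y^2], and the two squares on the left have the
   same expectation since [b] and [d] below are exchangeable; no moment has to be
   finite. *)
Lemma sqdist_conv p q h : (forall i, 0 <= p i)%R -> (forall i, 0 <= q i)%R ->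
  (forall i, 0 <= h i)%R ->
  psum p (fun=> 1) = 1 -> psum q (fun=> 1) = 1 -> is_conv p q h ->
  sqdist h = sqdist p + sqdist q.
Proof.
move=> p0 q0 h0 p1 q1 hE.
pose sq (i : int) : \bar R := ((i%:~R : R) ^+ 2)%:E.
have sq0 i : 0 <= sq i by rewrite lee_fin sqr_ge0.
(* [a] and [c] are copies with law [p], [b] and [d] copies with law [q]; [e] selects the sign in
   [(a - c) + (b - d)] or [(a - c) - (b - d)]. *)
pose F (e : bool) := psum p (fun a => psum p (fun c =>
  psum q (fun b => psum q (fun d => sq (a - c + (-1) ^+ e * (b - d))%R)))).
have E1 : sqdist h = F false.
  rewrite /sqdist (conv_psum _ _ _ hE)//; last first.
    by move=> i; apply: psum_ge0 => // j; exact: sq0.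
  apply: eq_psum => a.
  rewrite [RHS]psum_swap//; last by move=> *; apply: psum_ge0.
  apply: eq_psum => b; rewrite (conv_psum _ _ _ hE)//; last by move=> i; exact: sq0.
  apply: eq_psum => c; apply: eq_psum => d; congr (_%:~R ^+ 2)%:E.
  by rewrite expr0; ring.
have E2 : F true = F false.
  apply: eq_psum => a; apply: eq_psum => c; rewrite psum_swap//.
  apply: eq_psum => d; apply: eq_psum => b; congr (_%:~R ^+ 2)%:E.
  by rewrite expr0 expr1; ring.
pose S x := sq x + sq x.
have S0 i : 0 <= S i by rewrite adde_ge0.
have S2 r : (forall i, 0 <= r i)%R ->
    psum r (fun i => psum r (fun j => S (i - j)%R)) = sqdist r + sqdist r.
  move=> r0; have sqr0 i : 0 <= psum r (fun j => sq (i - j)%R).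
    exact: psum_ge0 r0 (fun j => sq0 (i - j)%R).
  apply: (psumD_eq r0 sqr0 sqr0) => i.
  exact: (psumD_eq r0 (fun j => sq0 (i - j)%R) (fun j => sq0 (i - j)%R) (fun=> erefl)).
have sS r (r0 : forall i, (0 <= r i)%R) i : 0 <= psum r (fun j => S (i - j)%R).
  exact: psum_ge0 r0 (fun j => S0 (i - j)%R).
have sF1 (e : bool) x b : 0 <= psum q (fun d => sq (x + (-1) ^+ e * (b - d))%R).
  exact: psum_ge0 q0 (fun d => sq0 _).
have sF2 (e : bool) x :
    0 <= psum q (fun b => psum q (fun d => sq (x + (-1) ^+ e * (b - d))%R)).
  exact: psum_ge0 q0 (sF1 e x).
have sF3 (e : bool) a : 0 <= psum p (fun c =>
    psum q (fun b => psum q (fun d => sq (a - c + (-1) ^+ e * (b - d))%R))).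
  exact: psum_ge0 p0 (fun c => sF2 e (a - c)%R).
have E3 : F false + F true = sqdist p + sqdist p + (sqdist q + sqdist q).
  transitivity (psum p (fun a => psum p (fun c => psum q (fun b => psum q (fun d =>
      S (a - c)%R + S (b - d)%R))))).
    symmetry; apply: (psumD_eq p0 (sF3 false) (sF3 true)) => a.
    apply: (psumD_eq p0 (fun c => sF2 false (a - c)%R) (fun c => sF2 true (a - c)%R)) => c.
    apply: (psumD_eq q0 (sF1 false (a - c)%R) (sF1 true (a - c)%R)) => b.
    apply: (psumD_eq q0 (fun d => sq0 _) (fun d => sq0 _)) => d.
    rewrite /S /sq -!EFinD; congr (_%:E).
    by rewrite expr0 expr1 !(rmorphB, rmorphD, rmorphM, rmorphN1)/=; ring.
  have q20 : 0 <= sqdist q + sqdist q.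
    exact: adde_ge0 (sqdist_ge0 q0) (sqdist_ge0 q0).
  transitivity (psum p (fun a => psum p (fun c => sqdist q + sqdist q + S (a - c)%R))).
    apply: eq_psum => a; apply: eq_psum => c; rewrite addeC -(S2 q q0).
    transitivity (psum q (fun b => S (a - c)%R + psum q (fun d => S (b - d)%R))).
      apply: eq_psum => b; exact: (psum_cstD q0 q1 (S0 _) (fun d => S0 (b - d)%R)).
    exact: (psum_cstD q0 q1 (S0 _) (sS q q0)).
  rewrite -(S2 p p0) [RHS]addeC.
  transitivity (psum p (fun a => sqdist q + sqdist q + psum p (fun c => S (a - c)%R))).
    apply: eq_psum => a; exact: (psum_cstD p0 p1 q20 (fun c => S0 (a - c)%R)).
  exact: (psum_cstD p0 p1 q20 (sS p p0)).
move: E3; rewrite E2 -E1 addeACA.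
have := sqdist_ge0 h0; have := adde_ge0 (sqdist_ge0 p0) (sqdist_ge0 q0).
(* Two doubled nonnegative extended reals are equal; the factor two cancels separately in the finite
   and infinite cases. *)
case: (sqdist h) => [x||]; case: (_ + _) => [y||]//= _ _ [].
by move=> e; congr (_%:E); lra.
Qed.

End psum.

Local Close Scope ereal_scope.

(** * Log-concavity of convolutions *)

Local Open Scope ereal_scope.

(* Cauchy-Binet for the 2 x 2 minors of the Toeplitz matrices of [p] and [q]. *)
Lemma log_concave_seq_conv (R : realType) (p q h : int -> R) :
  (forall i, 0 <= p i)%R -> (forall i, 0 <= q i)%R ->
  log_concave_seq p -> log_concave_seq q -> is_conv p q h ->
  log_concave_seq h.
Proof.
move=> p0 q0 lp lq hE u x y v ux uy uv.
have convE n (c : int) : (h n)%:E = \esum_(k in [set: int]) (p (n + c - k) * q (k - c))%:E.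
  rewrite hE esum_opp (esum_shift (- (n + c))); apply: eq_esum => k _.
  by congr ((p _ * q _)%:E); ring.
have h0 n : (0 <= h n)%R.
  by rewrite -lee_fin hE; apply: esum_ge0 => i _; rewrite lee_fin mulr_ge0.
have prodE n n' (c c' : int) : (h n * h n')%:E =
    \esum_(k in [set: int]) \esum_(l in [set: int])
      (p (n + c - k) * q (k - c) * (p (n' + c' - l) * q (l - c')))%:E.
  rewrite EFinM (convE n c) muleC -esum_mule ?lee_fin//; last first.
    by move=> k; rewrite lee_fin mulr_ge0.
  apply: eq_esum => k _; rewrite muleC (convE n' c') -esum_mule ?lee_fin ?mulr_ge0//.
  by move=> l; rewrite lee_fin mulr_ge0.
(* Shifting one summation index by [t] uses [u + t = x] and [v = y + t]: both products then carry
   the same factor [A] and differ only by exchanged indices in [B]. *)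
pose t : int := (x - u)%R.
pose A (k l : int) : R := (p (x - k) * p (y + t - l))%R.
pose B (k l : int) : R := (q k * q (l - t))%R.
have A0 k l : (0 <= A k l)%R by rewrite mulr_ge0.
have B0 k l : (0 <= B k l)%R by rewrite mulr_ge0.
have e1 : (h x * h y)%:E =
    \esum_(k in [set: int]) \esum_(l in [set: int]) (A k l * B k l)%:E.
  rewrite (prodE x y 0%R t); apply: eq_esum => k _; apply: eq_esum => l _.
  by rewrite /A /B addr0 subr0; congr (_%:E); ring.
have e2 : (h u * h v)%:E =
    \esum_(k in [set: int]) \esum_(l in [set: int]) (A k l * B l k)%:E.
  rewrite (prodE u v t 0%R); apply: eq_esum => k _; apply: eq_esum => l _.
  have -> : (u + t - k = x - k)%R by rewrite /t; ring.
  have -> : (v + 0 - l = y + t - l)%R by rewrite /t; lia.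
  by rewrite /A /B subr0; congr (_%:E); ring.
(* For [k <= l], log-concavity of [p] and of [q] makes both differences nonnegative; [ABs] is the
   resulting rearrangement inequality. *)
have AB k l : (k <= l)%R -> ((A k l - A l k) * (B k l - B l k) >= 0)%R.
  move=> kl; apply: mulr_ge0; rewrite subr_ge0.
    by rewrite /A; apply: lp; rewrite /t; lia.
  by rewrite /B mulrC [leRHS]mulrC; apply: lq; rewrite /t; lia.
have ABs k l : (A k l * B l k + A l k * B k l <= A k l * B k l + A l k * B l k)%R.
  by have [/AB|/ltW/AB] := leP k l; nra.
have sums f g : (forall k l : int, 0 <= f k l)%R -> (forall k l : int, 0 <= g k l)%R ->
    \esum_(k in [set: int]) \esum_(l in [set: int]) ((f k l)%:E + (g k l)%:E) =
    \esum_(k in [set: int]) \esum_(l in [set: int]) (f k l)%:E +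
    \esum_(k in [set: int]) \esum_(l in [set: int]) (g k l : R)%:E.
  move=> f0 g0; rewrite -esumD; last 2 first.
  - by move=> k _; apply: esum_ge0 => l _; rewrite lee_fin.
  - by move=> k _; apply: esum_ge0 => l _; rewrite lee_fin.
  by apply: eq_esum => k _; rewrite -esumD// => l _; rewrite lee_fin.
(* Each double sum is added to its transpose, so that [ABs] treats the pairs [(k, l)] and [(l, k)]
   together. *)
have e1' := e1; rewrite esum_swap in e1'; last first.
  by move=> k l; rewrite lee_fin mulr_ge0.
have e2' := e2; rewrite esum_swap in e2'; last first.
  by move=> k l; rewrite lee_fin mulr_ge0.
have : (h u * h v)%:E + (h u * h v)%:E <= (h x * h y)%:E + (h x * h y)%:E.
  rewrite {1}e2 e2' {1}e1 e1' -!sums; do ?by move=> k l; rewrite mulr_ge0.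
  apply: le_esum => k _; apply: le_esum => l _.
  by rewrite -!EFinD lee_fin; exact: ABs.
by rewrite -!EFinD lee_fin; lra.
Qed.

(** * One-sided log-concave sequences *)

Section tail_sums.
Variables (R : realFieldType) (x : nat -> R).
Hypotheses (x0 : (forall k, 0 <= x k)%R)
           (lx : (forall k j, x 0 * x (k + j)%N <= x k * x j)%R).
Local Open Scope ring_scope.

(* [x k t >= x 0 (x k + x k.+1 + ...)]: the discrete hazard rate increases. *)
Lemma tail_sum_le (phi : nat -> R) (N : nat) : (forall k, 0 <= phi k) ->
  x 0 * (\sum_(n < N) x n * \sum_(k < n.+1) phi k) <=
  (\sum_(k < N) x k) * (\sum_(k < N) phi k * x k).
Proof.
move=> phi0.
have -> : \sum_(n < N) x n * \sum_(k < n.+1) phi k =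
    \sum_(k < N) phi k * \sum_(n < N | (k <= n)%N) x n.
  transitivity (\sum_(n < N) \sum_(k < N | (k <= n)%N) phi k * x n).
    apply: eq_bigr => n _; rewrite mulr_sumr.
    rewrite (big_ord_widen_cond _ xpredT (fun k => x n * phi k) (ltn_ord n))/=.
    by apply: eq_big => [k|k _]; rewrite ?ltnS// mulrC.
  rewrite (exchange_big_dep xpredT)//=; apply: eq_bigr => k _.
  by rewrite mulr_sumr.
rewrite !mulr_sumr; apply: ler_sum => k _.
rewrite mulrCA [leRHS]mulrCA; apply: ler_wpM2l => //.
rewrite mulr_sumr [leRHS]mulrC mulr_sumr.
apply: (@le_trans _ _ (\sum_(n < N | (k <= n)%N) x k * x (n - k)%N)).
  by apply: ler_sum => n kn; have := lx k (n - k)%N; rewrite subnKC.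
rewrite -!mulr_sumr ler_wpM2l//.
rewrite -(big_geq_mkord k N xpredT (fun n => x (n - k)%N)) -{1}[nat_of_ord k]add0n big_addn.
under eq_bigr do rewrite addnK.
rewrite big_mkord (big_ord_widen _ _ (leq_subr k N)) [leRHS](bigID (fun i : 'I_N => (i < N - k)%N))/=.
by rewrite lerDl sumr_ge0.
Qed.

(** [tail_sum_le] with weights [1] and [k] gives [x 0 (m1 + t) <= t^2] and
    [x 0 (m2 + m1) <= 2 t m1]; eliminating [m1] yields the bound. *)
Lemma tail_moments_le (N : nat) (t := \sum_(k < N) x k)
    (m1 := \sum_(k < N) k%:R * x k) (m2 := \sum_(k < N) k%:R ^+ 2 * x k) :
  0 < x 0 -> m2 * x 0 ^+ 2 <= t * (t - x 0) * (2 * t - x 0).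
Proof.
move=> x00.
have h1 := tail_sum_le N (fun=> ler01 : (0 <= 1 :> R)).
have h2 := tail_sum_le N (fun k => ler0n R k).
have e1 : \sum_(n < N) x n * (\sum_(k < n.+1) 1) = m1 + t.
  rewrite /m1 /t -big_split/=; apply: eq_bigr => n _.
  by rewrite sumr_const card_ord -(natr1 n); ring.
have e2 : \sum_(n < N) x n * (\sum_(k < n.+1) k%:R) = (m2 + m1) / 2.
  rewrite /m2 /m1 -big_split/= mulr_suml; apply: eq_bigr => n _.
  by rewrite sum_ord_sqr -(natr1 n); field.
have e3 : \sum_(k < N) 1 * x k = t by apply: eq_bigr => k _; rewrite mul1r.
rewrite e1 e3 -/t in h1; rewrite e2 -/t -/m1 in h2.
have t0 : 0 <= t by apply: sumr_ge0.
have [N0|N0] := posnP N.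
  by rewrite /m2 /t N0 !big_ord0 !mul0r.
have tx : x 0 <= t.
  by rewrite /t -(prednK N0) big_ord_recl/= lerDl sumr_ge0.
have a : 0 <= x 0 * (2 * t * m1 - x 0 * (m2 + m1)) by apply: mulr_ge0 => //; lra.
have b : 0 <= (2 * t - x 0) * (t * t - x 0 * (m1 + t)) by apply: mulr_ge0; lra.
nra.
Qed.

(** [tail_sum_le] with [x] itself as weight; its double sum over [k <= n] is half of [t^2] plus the
    sum of squares. *)
Lemma sum_sqr_ge (N : nat) (t := \sum_(k < N) x k) :
  x 0 * t ^+ 2 <= (\sum_(k < N) x k ^+ 2) * (2 * t - x 0).
Proof.
have := tail_sum_le N x0.
have -> : \sum_(n < N) x n * (\sum_(k < n.+1) x k) =
    (t ^+ 2 + \sum_(k < N) x k ^+ 2) / 2.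
  rewrite /t; elim: N {t} => [|N IH]; first by rewrite !big_ord0; ring.
  by rewrite big_ord_recr/= IH !big_ord_recr/=; field.
have -> : \sum_(k < N) x k * x k = \sum_(k < N) x k ^+ 2 by [].
rewrite -/t; lra.
Qed.
End tail_sums.

Local Close Scope ereal_scope.

(** * Variance of a log-concave sequence *)

Lemma ler_sum_sub_seq (R : numDomainType) (T : eqType) (s t : seq T) (g : T -> R) :
  uniq s -> uniq t -> {subset s <= t} -> (forall i, 0 <= g i) ->
  \sum_(i <- s) g i <= \sum_(i <- t) g i.
Proof.
move=> us ut st g0; rewrite [leRHS](bigID (mem s))/= -[X in X + _]big_filter.
rewrite [X in _ <= X + _](perm_big s); first by rewrite lerDl sumr_ge0.
apply: uniq_perm => //; first exact: filter_uniq.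
by move=> x; rewrite mem_filter; apply/andP/idP => [[]//|xs]; split => //; exact: st.
Qed.

Definition int_ball (c : int) (N : nat) : seq int :=
  [seq c + k%:Z | k <- iota 0 N.+1] ++ [seq c - k.+1%:Z | k <- iota 0 N].

Lemma mem_int_ball c N z : (`|z - c| <= N)%N -> z \in int_ball c N.
Proof.
move=> zN; rewrite mem_cat; apply/orP; have [cz|cz] := leP c z.
- left; apply/mapP; exists `|z - c|%N; last by lia.
  by rewrite mem_iota; lia.
- right; apply/mapP; exists `|z - c|%N.-1; last by lia.
  by rewrite mem_iota; lia.
Qed.

Lemma int_ball_uniq c N : uniq (int_ball c N).
Proof.
rewrite cat_uniq !map_inj_uniq ?iota_uniq ?andbT/=.
- apply/hasPn => z /mapP[k _ ->]; apply/negP => H.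
  by have /mapP[j _] : c - k.+1%:Z \in [seq c + k%:Z | k <- iota 0 N.+1] := H; lia.
- by move=> i j; lia.
- by move=> i j; lia.
Qed.

Lemma sub_int_ball c (s : seq int) : exists N, {subset s <= int_ball c N}.
Proof.
exists (\sum_(z <- s) `|z - c|)%N => z zs; apply: mem_int_ball.
by rewrite (big_rem z)//= leq_addr.
Qed.

(** Both half-lines on the right contain [c], hence the extra [g c] on the left. *)
Lemma sum_int_ball (V : zmodType) (c : int) N (g : int -> V) :
  \sum_(z <- int_ball c N) g z + g c =
  \sum_(k < N.+1) g (c + k%:Z) + \sum_(k < N.+1) g (c - k%:Z).
Proof.
rewrite big_cat !big_map -addrA; congr (_ + _).
  by rewrite -[in LHS](subn0 N.+1) -/(index_iota 0 N.+1) big_mkord.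
rewrite [RHS]big_ord_recl/= subr0 addrC; congr (_ + _).
by rewrite -[in LHS](subn0 N) -/(index_iota 0 N) big_mkord.
Qed.

(* For [m = 1] the bound is attained asymptotically by two-sided geometric sequences. *)
Lemma int_ball_ge (R : realType) (c : int) N (f : int -> R)
    (M := f c) (m := \sum_(z <- int_ball c N) f z) :
  (forall z, 0 <= f z) -> log_concave_seq f -> 0 < M -> m <= 1 ->
  M * (m + M ^+ 2) / 2 <= \sum_(z <- int_ball c N) f z ^+ 2.
Proof.
move=> f0 lf M0 m1.
(* [sum_sqr_ge] gives [M (X + M)^2 / (4 X)] for one side. The tangent bound [1 / X >= 2 - X] makes
   this linear in [X], so the two sides add up to a function of the total mass only. *)
have side (x : nat -> R) (t := \sum_(k < N.+1) x k) (X := 2 * t - M) : x 0%N = M ->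
    (forall k, 0 <= x k) -> (forall k j, x 0%N * x (k + j)%N <= x k * x j) ->
    M * (X / 4 + M / 2 + M ^+ 2 * (2 - X) / 4) <= \sum_(k < N.+1) x k ^+ 2.
  move=> x0M x0 lx; have := sum_sqr_ge x0 lx N.+1; rewrite -/t x0M -/X.
  have tM : M <= t by rewrite /t big_ord_recl/= x0M lerDl sumr_ge0.
  have X0 : 0 < X by rewrite /X; lra.
  set Q := \sum_(k < _) _ => HQ.
  rewrite -(ler_pM2r X0); apply: le_trans HQ.
  have -> : t = (X + M) / 2 by rewrite /X; field.
  have : 0 <= M * (M ^+ 2 * (1 - X) ^+ 2).
    exact: (mulr_ge0 (ltW M0) (mulr_ge0 (sqr_ge0 M) (sqr_ge0 (1 - X)))).
  lra.
have cx0 : f (c + 0%:Z) = M by rewrite addr0.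
have cy0 : f (c - 0%:Z) = M by rewrite subr0.
have lx k j : f (c + 0%:Z) * f (c + (k + j)%N%:Z) <= f (c + k%:Z) * f (c + j%:Z).
  by apply: lf; lia.
have ly k j : f (c - 0%:Z) * f (c - (k + j)%N%:Z) <= f (c - k%:Z) * f (c - j%:Z).
  by rewrite mulrC; apply: lf; lia.
have hx := side (fun k : nat => f (c + k%:Z)) cx0 (fun=> f0 _) lx.
have hy := side (fun k : nat => f (c - k%:Z)) cy0 (fun=> f0 _) ly.
have sf := sum_int_ball c N f; have sq := sum_int_ball c N (fun z => f z ^+ 2).
rewrite -/M -/m in sf sq.
move: hx hy sf sq.
set tx := \sum_(k < _) f (c + _); set ty := \sum_(k < _) f (c - _).
set Qx := \sum_(k < _) f (c + _) ^+ 2; set Qy := \sum_(k < _) f (c - _) ^+ 2.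
set q := \sum_(_ <- _) _ => hx hy sf sq.
have tyE : ty = m + M - tx by lra.
have qE : q = Qx + Qy - M ^+ 2 by lra.
rewrite qE; rewrite tyE in hy.
have : 0 <= M * (M ^+ 2 * (1 - m)).
  by apply: (mulr_ge0 (ltW M0) (mulr_ge0 (sqr_ge0 M) _)); rewrite subr_ge0.
lra.
Qed.

Local Open Scope ereal_scope.

Section log_concave_pmf.
Variables (R : realType) (f : int -> R).
Hypotheses (f0 : forall z, (0 <= f z)%R) (lf : log_concave_seq f).
Hypothesis f1 : \esum_(z in [set: int]) (f z)%:E = 1.

Lemma psum_mass : psum f (fun=> 1) = 1.
Proof. by rewrite -[RHS]f1; apply: eq_esum => i _; rewrite mule1. Qed.

Lemma seq_mass_le1 s : uniq s -> (\sum_(z <- s) f z <= 1)%R.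
Proof. by move=> us; rewrite -lee_fin -sumEFin -f1; exact: seq_le_esum. Qed.

Lemma pmf_le1 z : (f z <= 1)%R.
Proof. by have := @seq_mass_le1 [:: z] isT; rewrite big_seq1. Qed.

(** Outside a finite [s] of mass above [1 - f z] and other than at [z], all values are below [f z],
    so the maximum over [z :: s] is global. *)
Lemma pmf_has_max : exists2 c, (0 < f c)%R & forall z, (f z <= f c)%R.
Proof.
have [z fz] : exists z, (0 < f z)%R.
  apply/not_existsP => H; have : \esum_(z in [set: int]) (f z)%:E = 0.
    apply: esum1 => z _; congr (_%:E); apply/eqP; rewrite eq_le f0 andbT leNgt.
    by apply/negP/H.
  by rewrite f1 => /eqP; rewrite onee_eq0.
have : (1 - f z)%:E < \esum_(z in [set: int]) (f z)%:E.
  by rewrite f1 lte_fin gtrBl.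
move=> /lt_esum_seq[s us]; rewrite sumEFin lte_fin => sz.
have [c cs cmax] := @seq_argmax _ _ _ f (z :: s) isT.
have zc : (f z <= f c)%R by apply: cmax; rewrite inE eqxx.
exists c => [|x]; first exact: lt_le_trans fz zc.
have [xs|xs] := boolP (x \in z :: s); first exact: cmax.
have : uniq (x :: s) by rewrite /= us andbT; apply: contra xs; rewrite inE orbC => ->.
by move=> /seq_mass_le1; rewrite big_cons; lra.
Qed.

(** The law of the difference of two independent copies; the sum is at most one, so [fine] loses
    nothing. *)
Definition autocorr (n : int) : R := fine (\esum_(i in [set: int]) (f i * f (i - n))%:E).

Lemma autocorr_conv : is_conv f (fun z => f (- z)%R) autocorr.
Proof.
move=> n; rewrite fineK; first by apply: eq_esum => i _; rewrite opprB.
rewrite ge0_fin_numE; last by apply: esum_ge0 => i _; rewrite lee_fin mulr_ge0.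
apply: (@le_lt_trans _ _ 1); last by rewrite ltry.
rewrite -f1; apply: le_esum => i _; rewrite lee_fin.
by rewrite ler_piMr// pmf_le1.
Qed.

Local Notation r := autocorr.

Lemma autocorr_ge0 n : (0 <= r n)%R.
Proof. by apply: fine_ge0; apply: esum_ge0 => i _; rewrite lee_fin mulr_ge0. Qed.

Lemma autocorrN n : r (- n)%R = r n.
Proof.
congr fine; rewrite (esum_shift (- n)); apply: eq_esum => i _.
by rewrite opprK subrK mulrC.
Qed.

Lemma autocorr_log_concave : log_concave_seq r.
Proof.
apply: (log_concave_seq_conv _ _ lf _ autocorr_conv) => // u x y v ux uy uv.
by rewrite mulrC; apply: lf; lia.
Qed.

Let f0' z : (0 <= f (- z))%R. Proof. exact: f0. Qed.

Lemma autocorr_mass : psum r (fun=> 1) = 1.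
Proof.
rewrite (conv_psum f0 f0' (fun=> lee01) autocorr_conv) -[RHS]psum_mass.
apply: eq_psum => a; rewrite -[RHS]psum_mass /psum [RHS]esum_opp.
by [].
Qed.

Lemma autocorr_seq_le1 s : uniq s -> (\sum_(z <- s) r z <= 1)%R.
Proof.
move=> us; rewrite -lee_fin -sumEFin -autocorr_mass.
rewrite /psum; under eq_esum do rewrite mule1.
exact: (@seq_le_esum _ _ (fun i => (r i)%:E)).
Qed.

Lemma sqdist_autocorr :
  sqdist f = \esum_(n in [set: int]) (r n * n%:~R ^+ 2)%:E.
Proof.
pose sq (i : int) : \bar R := ((i%:~R : R) ^+ 2)%:E.
have sq0 i : 0 <= sq i by rewrite lee_fin sqr_ge0.
transitivity (psum r sq); last by [].
rewrite (conv_psum f0 f0' sq0 autocorr_conv).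
by apply: eq_psum => a; rewrite /psum [RHS]esum_opp; apply: eq_esum => b _; rewrite opprK.
Qed.

Lemma autocorr0_ge s : uniq s -> (\sum_(z <- s) f z ^+ 2 <= r 0)%R.
Proof.
move=> us; rewrite -lee_fin -sumEFin autocorr_conv.
under eq_esum do rewrite sub0r opprK -expr2.
exact: (@seq_le_esum _ _ (fun i => (f i ^+ 2)%:E)).
Qed.

Lemma sqdist_le_autocorr : (0 < r 0)%R ->
  sqdist f <= ((1 - r 0 ^+ 2) / (2 * r 0 ^+ 2))%:E.
Proof.
move=> r0; rewrite sqdist_autocorr; apply: esum_le_seq => s us.
have [N sN] := sub_int_ball 0 s.
rewrite sumEFin lee_fin.
have g0 z : (0 <= r z * z%:~R ^+ 2)%R by rewrite mulr_ge0 ?sqr_ge0 ?autocorr_ge0.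
apply: le_trans (ler_sum_sub_seq us (int_ball_uniq 0 N) sN g0) _.
have lr := autocorr_log_concave.
have lx k j : (r 0%:Z * r (k + j)%N%:Z <= r k%:Z * r j%:Z)%R by apply: lr; lia.
have := tail_moments_le (fun k => autocorr_ge0 k%:Z) lx N.+1 r0.
set t := (\sum_(k < N.+1) r k%:Z)%R; set m2 := (\sum_(k < N.+1) _)%R => H.
have mE : (\sum_(z <- int_ball 0 N) r z + r 0 = 2 * t)%R.
  rewrite sum_int_ball mulr_natl mulr2n; congr (_ + _)%R; apply: eq_bigr => k _.
  by rewrite sub0r autocorrN.
have -> : (\sum_(z <- int_ball 0 N) r z * z%:~R ^+ 2 = 2 * m2)%R.
  rewrite -[LHS]addr0 -[X in (_ + X)%R](_ : (r 0 * 0%:~R ^+ 2 = 0)%R); last first.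
    by rewrite mulr0z expr0n mulr0.
  rewrite (sum_int_ball 0 N (fun z => r z * z%:~R ^+ 2)%R) mulr_natl mulr2n.
  congr (_ + _)%R; apply: eq_bigr => k _; first by rewrite add0r mulrC.
  by rewrite sub0r autocorrN rmorphN/= sqrrN mulrC.
have m1 := autocorr_seq_le1 (int_ball_uniq 0 N).
have t1 : (2 * t <= 1 + r 0)%R by lra.
have rt : (r 0 <= t)%R.
  by rewrite /t big_ord_recl/= lerDl sumr_ge0// => i _; exact: autocorr_ge0.
rewrite ler_pdivlMr ?mulr_gt0 ?exprn_gt0//.
(* From [2 t <= 1 + r 0] the factors are at most [(1 + r 0) / 2], [(1 - r 0) / 2] and [1]. *)
suff : (t * (t - r 0) * (2 * t - r 0) <= (1 - r 0 ^+ 2) / 4)%R by move: H; lra.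
have p0 : (0 <= t * (t - r 0))%R by rewrite mulr_ge0 ?subr_ge0// (le_trans _ rt)// ltW.
apply: (@le_trans _ _ (t * (t - r 0) * 1)%R); first by rewrite ler_wpM2l//; lra.
rewrite mulr1.
have : (t * (t - r 0) <= (1 + r 0) / 2 * ((1 - r 0) / 2))%R by apply: ler_pM; lra.
lra.
Qed.

(** [int_ball_ge] applies to balls of mass arbitrarily close to one, over which the sum of squares
    stays below [r 0]. *)
Lemma max_le_autocorr0 c : (0 < f c)%R -> (f c * (1 + f c ^+ 2) / 2 <= r 0)%R.
Proof.
move=> M0; set M := f c.
have M1 : (M <= 1)%R by exact: pmf_le1.
apply/ler_addgt0Pr => e e0.
have : (1 - e)%:E < \esum_(z in [set: int]) (f z)%:E by rewrite f1 lte_fin gtrBl.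
move=> /lt_esum_seq[s us]; rewrite sumEFin lte_fin => se.
have [N sN] := sub_int_ball c s.
have := ler_sum_sub_seq us (int_ball_uniq c N) sN f0.
have b1 := seq_mass_le1 (int_ball_uniq c N).
have := autocorr0_ge (int_ball_uniq c N).
have := int_ball_ge f0 lf M0 b1; rewrite -/M.
set m := (\sum_(z <- int_ball c N) f z)%R; set q := (\sum_(z <- int_ball c N) _)%R.
move=> h1 h2 h3.
have : (M * (1 - e) <= M * m)%R by rewrite ler_wpM2l ?(ltW M0)//; lra.
have : (M * e <= 1 * e)%R by rewrite ler_wpM2r// ltW.
lra.
Qed.

Lemma sqdist_le_max c : (0 < f c)%R -> 2^-1%:E * sqdist f <= ((f c) ^- 2 - 1)%:E.
Proof.
move=> M0; have := max_le_autocorr0 M0; set M := f c => rM.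
have M1 : (M <= 1)%R by exact: pmf_le1.
have Mp : (0 < M * (1 + M ^+ 2) / 2)%R.
  by rewrite divr_gt0// mulr_gt0// ltr_pwDl// sqr_ge0.
have r0 : (0 < r 0)%R by exact: lt_le_trans Mp rM.
have h : 0 <= 2^-1%:E :> \bar R by rewrite lee_fin.
apply: le_trans (lee_wpmul2l h (sqdist_le_autocorr r0)) _.
rewrite -EFinM lee_fin.
set rr := r 0 in rM r0 *.
have e1 : (2^-1 * ((1 - rr ^+ 2) / (2 * rr ^+ 2)) = (1 - rr ^+ 2) / (4 * rr ^+ 2))%R.
  by field; lra.
have M20 : (0 < M ^+ 2)%R by rewrite exprn_gt0.
have e2 : (M ^- 2 - 1 = (1 - M ^+ 2) / M ^+ 2)%R by field; rewrite gt_eqF.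
rewrite e1 e2 ler_pdivrMr; last by rewrite mulr_gt0// exprn_gt0.
rewrite [leRHS]mulrAC ler_pdivlMr//.
have h2 : ((M * (1 + M ^+ 2) / 2) ^+ 2 <= rr ^+ 2)%R.
  by rewrite ler_sqr ?nnegrE ?(ltW Mp) ?(ltW r0).
set u := (M ^+ 2)%R in M20 h2 *.
have u1 : (u <= 1)%R by rewrite /u expr_le1// ltW.
have e3 : ((M * (1 + u) / 2) ^+ 2 = u * (1 + u) ^+ 2 / 4)%R by rewrite /u; field.
rewrite e3 in h2; move: h2; set w := (rr ^+ 2)%R => h2.
(* The goal amounts to [u <= w (4 - 3 u)]. By [h2] it follows from [(1 + u)^2 (4 - 3 u) - 4 = u (1 -
   u) (5 + 3 u)], which is nonnegative. *)
have : (u * (1 + u) ^+ 2 / 4 * (4 - 3 * u) <= w * (4 - 3 * u))%R.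
  by rewrite ler_wpM2r//; lra.
have : (0 <= u * (u * ((1 - u) * (5 + 3 * u))))%R.
  apply: (mulr_ge0 (ltW M20)); apply: (mulr_ge0 (ltW M20)).
  by apply: mulr_ge0; lra.
lra.
Qed.

(** With [M] the maximum, [f^a <= M^(a - 1) f] bounds the power sum by [M^(a - 1)], hence the
    entropy power is at least [M^-2]. *)
Lemma esum_renyi_ge (a : R) : (1 < a)%R ->
  2^-1%:E * sqdist f <=
  (\esum_(z in [set: int]) (f z `^ a)%:E) `^ (- 2 / (a - 1)) - 1.
Proof.
move=> a1; have a1' : (0 < a - 1)%R by rewrite subr_gt0.
have [c M0 cmax] := pmf_has_max; set M := f c in M0 *.
apply: le_trans (sqdist_le_max M0) _.
set G := \esum_(z in _) _.
have GM : G <= (M `^ (a - 1))%:E.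
  rewrite -[leRHS]mule1 -f1 -esumZl ?powR_ge0//.
  apply: le_esum => z _; rewrite -EFinM lee_fin.
  have [->|fz] := eqVneq (f z) 0%R.
    by rewrite powR0 ?mulr0// gt_eqF// (lt_trans _ a1).
  rewrite -[X in (_ `^ X <= _)%R](subrK 1%R) (@powRD _ (f z) (a - 1) 1) ?fz ?implybT//.
  rewrite powRr1//.
  by rewrite ler_wpM2r// ge0_ler_powR ?nnegrE ?(ltW a1') ?cmax// ltW.
have Gc : (f c `^ a)%:E <= G.
  by have := @seq_le_esum _ _ (fun z => (f z `^ a)%:E) [:: c] isT; rewrite big_seq1.
have : G \is a fin_num.
  rewrite ge0_fin_numE; first by apply: le_lt_trans GM _; rewrite ltry.
  by apply: le_trans Gc; rewrite lee_fin powR_ge0.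
case: G GM Gc => [g||]//; rewrite !lee_fin => GM Gc _.
have g0 : (0 < g)%R by apply: lt_le_trans Gc; exact: powR_gt0.
rewrite lerD2r mulNr.
have k0 : (0 <= 2 / (a - 1))%R by rewrite divr_ge0// ltW.
apply: le_trans (ler_npowR g0 k0 GM).
rewrite -powRrM mulrN mulrCA divff ?gt_eqF// mulr1 powRN powR_mulrn// ltW//.
Qed.

End log_concave_pmf.

Local Close Scope ereal_scope.

(** * Partial sums of independent variables *)

(** Ratios of consecutive values do not increase along the support, which gives [step]; contiguity
    supplies the positive factors cancelled there. Iterating it moves both endpoints inwards, in
    [main]. *)
Lemma log_concave_seqP (R : realType) (f : int -> R) :
  (forall z, 0 <= f z) ->
  (forall z, f (z - 1) * f (z + 1) <= f z ^+ 2) ->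
  (forall a b c : int, a <= b -> b <= c -> 0 < f a -> 0 < f c -> 0 < f b) ->
  log_concave_seq f.
Proof.
move=> f0 f2 fc.
have step (u : int) (m : nat) : f u * f (u + m.+1%:Z) <= f (u + 1) * f (u + m%:Z).
  have [fu|fu] := ltP 0 (f u); last first.
    have -> : f u = 0 by apply/eqP; rewrite eq_le fu f0.
    by rewrite mul0r mulr_ge0.
  elim: m => [|m IH]; first by rewrite addr0 mulrC.
  have [fv|fv] := ltP 0 (f (u + m.+2%:Z)); last first.
    have -> : f (u + m.+2%:Z) = 0 by apply/eqP; rewrite eq_le fv f0.
    by rewrite mulr0 mulr_ge0.
  have f1 : 0 < f (u + m.+1%:Z) by apply: (fc u _ (u + m.+2%:Z)) => //; lia.
  have f3 : 0 < f (u + m%:Z) by apply: (fc u _ (u + m.+2%:Z)) => //; lia.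
  have := f2 (u + m.+1%:Z).
  have -> : u + m.+1%:Z - 1 = u + m%:Z by lia.
  have -> : u + m.+1%:Z + 1 = u + m.+2%:Z by lia.
  move=> H; rewrite -(ler_pM2r (mulr_gt0 f3 f1)).
  have := ler_pM (mulr_ge0 (f0 _) (f0 _)) (mulr_ge0 (f0 _) (f0 _)) IH H.
  nra.
have main (d : nat) (u v : int) :
    u + d%:Z <= v - d%:Z -> f u * f v <= f (u + d%:Z) * f (v - d%:Z).
  elim: d => [|d IH] uv; first by rewrite addr0 subr0.
  apply: le_trans (IH _) _; first by lia.
  have [m mE] : exists m : nat, (v - d%:Z)%R = (u + d%:Z + m.+1%:Z)%R :> int.
    by exists `|(v - d%:Z - (u + d%:Z))%R|%N.-1; lia.
  have := step (u + d%:Z) m; rewrite -mE.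
  have -> : u + d%:Z + 1 = u + d.+1%:Z by lia.
  by have -> : u + d%:Z + m%:Z = v - d.+1%:Z by lia.
move=> u x y v ux uy uv.
wlog xy : x y ux uy uv / x <= y.
  move=> H; have [|/ltW yx] := leP x y; first exact: H.
  by rewrite [leRHS]mulrC; apply: H => //; rewrite uv addrC.
have := main `|x - u|%N u v.
have -> : u + `|x - u|%N%:Z = x by lia.
have -> : v - `|x - u|%N%:Z = y by lia.
exact.
Qed.

Local Open Scope ereal_scope.
Local Open Scope classical_set_scope.

Lemma probability_int_decomp d (T : measurableType d) (R : realType)
    (P : probability T R) (X : {RV P >-> R}) (A : set T) :
  integer_valued X -> measurable A ->
  P A = \esum_(z in [set: int]) P (A `&` X @^-1` [set z%:~R]).
Proof.
move=> Xint mA.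
(* Countable additivity runs over codes of integers. Codes that decode to nothing are sent to [0] by
   the default; restricting to [D] prevents them from repeating the event of [0]. *)
pose D := range (@pickle int).
pose F n := A `&` X @^-1` [set (odflt 0%R (@unpickle int n))%:~R].
have mF n : measurable (F n).
  by apply: measurableI => //; rewrite -[X in measurable X]setTI; exact: measurable_funP.
have AE : A = \bigcup_(n in D) F n.
  apply/seteqP; split => [w Aw|w [n _ []//]].
  have /Num.Theory.intrP[z zE] := Xint w.
  by exists (pickle z); [exists z|rewrite /F pickleK].
have tF : trivIset D F.
  move=> _ _ [z _ <-] [z' _ <-] [w []]; rewrite /F !pickleK/= => -[_ ->] [_].
  by move=> /eqP; rewrite eqr_int => /eqP ->.
rewrite {1}AE measure_bigcup// nneseries_esum//.
transitivity (\esum_(n in D) P (F n)).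
  by congr esum; apply/seteqP; split => n /=; rewrite inE.
rewrite esum_image; last by move=> z z' _ _; exact: (pcan_inj pickleK).
by apply: eq_esum => z _; rewrite /F pickleK.
Qed.

Section partial_sums.
Variables (d : measure_display) (T : measurableType d) (R : realType)
  (P : probability T R) (n : nat) (X : 'I_n -> {RV P >-> R}).
Hypotheses (Xint : forall i, integer_valued (X i)) (hind : independent_RVs X).

Definition partial_sum (k : nat) : {RV P >-> R} :=
  (\sum_(i < n | (i < k)%N) (X i : {mfun T >-> R}))%R.

Lemma partial_sumE k w :
  partial_sum k w = (\sum_(i < n | (i < k)%N) X i w)%R.
Proof. exact: mfun_sum. Qed.

Lemma partial_sumS k (kn : (k < n)%N) w :
  partial_sum k.+1 w = (X (Ordinal kn) w + partial_sum k w)%R.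
Proof.
rewrite !partial_sumE (bigD1 (Ordinal kn))/=; last by rewrite ltnS.
congr (_ + _)%R; apply: eq_bigl => i.
by rewrite -val_eqE/= ltnS [RHS]ltn_neqAle andbC.
Qed.

Lemma int_pmfE (Y : {RV P >-> R}) z :
  (int_pmf Y z)%:E = P (Y @^-1` [set z%:~R]).
Proof. by rewrite /int_pmf /pmf fineK// fin_num_measure//; exact: measurable_funPTI. Qed.

Lemma int_pmf_ge0 (Y : {RV P >-> R}) z : (0 <= int_pmf Y z)%R.
Proof. exact: pmf_ge0. Qed.

Lemma int_pmf_mass (Y : {RV P >-> R}) : integer_valued Y ->
  \esum_(z in [set: int]) (int_pmf Y z)%:E = 1.
Proof.
move=> Yint; rewrite -(probability_setT P) (probability_int_decomp Yint)//.
by apply: eq_esum => z _; rewrite int_pmfE setTI.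
Qed.

Let box (J : {set 'I_n}) (B : 'I_n -> set R) : set T :=
  \bigcap_(i in [set` J]) (X i @^-1` B i).

Let measurable_box J B : (forall i, measurable (B i)) -> measurable (box J B).
Proof.
move=> mB; apply: fin_bigcap_measurable => // i _; exact: measurable_funPTI.
Qed.

(* The events on the later variables are carried along so that the induction on [k]
   can split off the next variable. *)
Lemma partial_sum_indep k (J : {set 'I_n}) (B : 'I_n -> set R) z :
  (k <= n)%N -> (forall i, i \in J -> (k <= i)%N) ->
  (forall i, measurable (B i)) ->
  P (partial_sum k @^-1` [set z%:~R] `&` box J B) =
  P (partial_sum k @^-1` [set z%:~R]) * \prod_(i in J) P (X i @^-1` B i).
Proof.
elim: k J B z => [|k IH] J B z kn JB mB.
  have S0 w : partial_sum 0 w = 0%R by rewrite partial_sumE big_pred0.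
  have [->|z0] := eqVneq z 0%R.
    have -> : partial_sum 0 @^-1` [set 0%:~R] = setT.
      by apply/seteqP; split => // w _; rewrite /= S0.
    by rewrite setTI probability_setT mul1e; exact: hind.
  have -> : partial_sum 0 @^-1` [set z%:~R] = set0.
    apply/seteqP; split => // w /=; rewrite S0 => /esym/eqP.
    by rewrite intr_eq0 (negbTE z0).
  by rewrite set0I measure0 mul0e.
pose i0 := Ordinal kn.
have i0J : i0 \notin J by apply/negP => /JB; rewrite ltnn.
have key (J' : {set 'I_n}) (B' : 'I_n -> set R) :
    (forall i, i \in J' -> (k < i)%N) -> (forall i, measurable (B' i)) ->
    P (partial_sum k.+1 @^-1` [set z%:~R] `&` box J' B') =
    \esum_(b in [set: int]) ((int_pmf (X i0) b * int_pmf (partial_sum k) (z - b))%:E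
       * \prod_(i in J') P (X i @^-1` B' i)).
  move=> kJ mB'.
  have i0J' : i0 \notin J' by apply/negP => /kJ; rewrite ltnn.
  rewrite (probability_int_decomp (Xint i0)); last first.
    by apply: measurableI; [exact: measurable_funPTI|exact: measurable_box].
  apply: eq_esum => b _.
  (* On [X i0 = b] the event concerns [partial_sum k] alone once this constraint joins the box, so
     the induction hypothesis applies. *)
  pose B'' i := if i == i0 then [set b%:~R] else B' i.
  have -> : partial_sum k.+1 @^-1` [set z%:~R] `&` box J' B' `&` X i0 @^-1` [set b%:~R]
     = partial_sum k @^-1` [set (z - b)%:~R] `&` box (i0 |: J') B''.
    apply/seteqP; split => w.
      move=> [[/= Sz Jw] Xb]; split => [/=|i].
        by rewrite rmorphB/= -Sz -Xb (partial_sumS kn) addrC addKr.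
      by rewrite /= !inE /B''; case: eqP => [-> _//|_ /= iJ]; exact: Jw.
    move=> [/= Sz Jw]; have Xb : X i0 w = b%:~R.
      by have := Jw i0; rewrite /= !inE eqxx /B'' eqxx; exact.
    split => //; split => [|i /= iJ].
      by rewrite /= (partial_sumS kn) Sz Xb rmorphB/= subrKC.
    have := Jw i; rewrite /= !inE iJ orbT /B'' => /(_ isT).
    by case: eqP => // ii0; rewrite -ii0 iJ in i0J'.
  rewrite IH//; last 3 first.
  - exact: ltnW.
  - by move=> i; rewrite !inE => /predU1P[->//|/kJ/ltnW].
  - by move=> i; rewrite /B''; case: ifP.
  rewrite big_setU1//= {1}/B'' eqxx -int_pmfE -int_pmfE muleA -EFinM [in RHS]mulrC.
  congr (_ * _); apply: eq_bigr => i iJ; rewrite /B''.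
  by case: eqP => // ii0; rewrite -ii0 iJ in i0J'.
have fac (J' : {set 'I_n}) (B' : 'I_n -> set R) : (forall i, measurable (B' i)) ->
    \esum_(b in [set: int]) ((int_pmf (X i0) b * int_pmf (partial_sum k) (z - b))%:E
       * \prod_(i in J') P (X i @^-1` B' i)) =
    (\esum_(b in [set: int]) (int_pmf (X i0) b * int_pmf (partial_sum k) (z - b))%:E)
      * \prod_(i in J') P (X i @^-1` B' i).
  move=> mB'; under eq_esum do rewrite muleC.
  rewrite esum_mule; [by rewrite muleC|by move=> b; rewrite lee_fin mulr_ge0 ?int_pmf_ge0|].
  by apply: prode_ge0 => i _; exact: measure_ge0.
rewrite key// fac//; congr (_ * _).
(* The empty box identifies the convolution sum as the law of [partial_sum k.+1]. *)
have := key finset.set0 (fun=> setT) _ (fun=> measurableT).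
rewrite fac// big_set0 mule1 => <-; last by move=> i; rewrite inE.
congr (P _); rewrite /box [X in _ `&` X](_ : _ = setT) ?setIT//.
by apply/seteqP; split => // w _ i /=; rewrite inE.
Qed.

Lemma partial_sum_conv k (kn : (k < n)%N) :
  is_conv (int_pmf (X (Ordinal kn))) (int_pmf (partial_sum k))
          (int_pmf (partial_sum k.+1)).
Proof.
move=> z; rewrite int_pmfE (probability_int_decomp (Xint (Ordinal kn))); last first.
  exact: measurable_funPTI.
apply: eq_esum => b _.
have -> : partial_sum k.+1 @^-1` [set z%:~R] `&` X (Ordinal kn) @^-1` [set b%:~R] =
    partial_sum k @^-1` [set (z - b)%:~R] `&`
    box [set Ordinal kn]%SET (fun=> [set b%:~R]).
  apply/seteqP; split => w.
    move=> [/= Sz Xb]; split => [/=|i].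
      by rewrite rmorphB/= -Sz -Xb (partial_sumS kn) addrC addKr.
    by rewrite /= inE => /eqP ->.
  move=> [/= Sz Jw]; have Xb : X (Ordinal kn) w = b%:~R.
    by apply: (Jw (Ordinal kn)); rewrite /= inE.
  by split => //=; rewrite (partial_sumS kn) Sz Xb rmorphB/= subrKC.
rewrite partial_sum_indep//; last 2 first.
- exact: ltnW.
- by move=> i; rewrite inE => /eqP ->.
by rewrite big_set1 -!int_pmfE -EFinM mulrC.
Qed.

End partial_sums.

Local Close Scope classical_set_scope.

Local Close Scope ereal_scope.

Local Open Scope ereal_scope.
Local Open Scope classical_set_scope.

Lemma log_concave_seq_delta (R : realType) (f : int -> R) :
  (forall z, f z = (z == 0%R)%:R) -> log_concave_seq f.
Proof.
move=> fE u x y v ux uy uv; rewrite !fE.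
have [u0|u0] := eqVneq u 0%R; last by rewrite mul0r mulr_ge0 ?ler0n.
have [v0|v0] := eqVneq v 0%R; last by rewrite mulr0 mulr_ge0 ?ler0n.
have -> : x = 0%R by lia.
have -> : y = 0%R by lia.
by rewrite eqxx.
Qed.

Section sum_of_independent.
Variables (d : measure_display) (T : measurableType d) (R : realType)
  (P : probability T R) (n : nat) (X : 'I_n -> {RV P >-> R}).
Hypotheses (hlc : forall i, discrete_log_concave (X i)) (hind : independent_RVs X).

Let Xint i : integer_valued (X i). Proof. by case: (hlc i). Qed.

Lemma int_pmf_log_concave i : log_concave_seq (int_pmf (X i)).
Proof.
by case: (hlc i) => _ h1 h2; apply: log_concave_seqP => //; exact: int_pmf_ge0.
Qed.

Let S k := partial_sum X k.

(** The induction starts from the point mass of the empty sum; the total mass is carried along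
    because [sqdist_conv] requires it. *)
Lemma partial_sum_properties k : (k <= n)%N ->
  [/\ psum (int_pmf (S k)) (fun=> 1) = 1,
      log_concave_seq (int_pmf (S k)) &
      sqdist (int_pmf (S k)) = \sum_(i < n | (i < k)%N) sqdist (int_pmf (X i))].
Proof.
elim: k => [|k IH] kn.
  have S0 w : S 0 w = 0%R by rewrite /S partial_sumE big_pred0.
  have S0E z : int_pmf (S 0) z = (z == 0%R)%:R.
    apply: EFin_inj; rewrite int_pmfE.
    have [->|z0] := eqVneq z 0%R.
      rewrite (_ : _ @^-1` _ = setT) ?probability_setT//.
      by apply/seteqP; split => // w _; rewrite /= S0.
    rewrite (_ : _ @^-1` _ = set0) ?measure0//.
    apply/seteqP; split => // w /=; rewrite S0 => /esym/eqP.
    by rewrite intr_eq0 (negbTE z0).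
  split; last 2 first.
  - exact: log_concave_seq_delta.
  - rewrite big_pred0//; apply: esum1 => i _; rewrite S0E.
    have [->|i0] := eqVneq i 0%R; last by rewrite mul0e.
    rewrite mul1e; apply: esum1 => j _; rewrite S0E.
    have [->|j0] := eqVneq j 0%R; last by rewrite mul0e.
    by rewrite subrr mulr0z expr0n mule0.
  apply: psum_mass; apply: int_pmf_mass => w; rewrite S0; exact: rpred0.
have [h1 h2 h3] := IH (ltnW kn).
have hc := partial_sum_conv Xint hind kn.
have X1 := psum_mass (int_pmf_mass (Xint (Ordinal kn))).
have p0 := @int_pmf_ge0 _ _ _ P.
split.
- rewrite (conv_psum (p0 _) (p0 _) (fun=> lee01) hc) -[RHS]X1.
  by apply: eq_psum => i; exact: h1.
- exact: (log_concave_seq_conv (p0 _) (p0 _) (int_pmf_log_concave _) h2 hc).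
- rewrite (sqdist_conv (p0 _) (p0 _) (p0 _) X1 h1 hc) h3.
  rewrite [RHS](bigD1 (Ordinal kn))/=; last by rewrite ltnS.
  congr (_ + _); apply: eq_bigl => i.
  by rewrite -val_eqE/= ltnS ltn_neqAle andbC.
Qed.

End sum_of_independent.

Local Close Scope ereal_scope.
Local Close Scope classical_set_scope.

Theorem theorem1p5 (d : measure_display) (T : measurableType d) (R : realType)
    (P : probability T R) (n : nat) (X : 'I_n -> {RV P >-> R})
    (hlc : forall i, discrete_log_concave (X i))
    (hind : independent_RVs X)
    (alpha : R) (halpha : 1 < alpha) :
  (((alpha - 1) / (4 * (3 * alpha - 1)))%:E *
     \sum_(i < n) renyi_delta alpha (X i)
   <= renyi_delta alpha (sum_RV X))%E.
Proof.
have a1' : 0 < alpha - 1 by rewrite subr_gt0.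
have a0 : 0 < alpha by exact: lt_trans ltr01 halpha.
have [S1 Slc SD] := partial_sum_properties hlc hind (leqnn n).
have SE : sum_RV X = partial_sum X n.
  by rewrite /sum_RV /partial_sum; apply: eq_bigl => i; rewrite ltn_ord.
rewrite SE.
have Xint i : integer_valued (X i) by case: (hlc i).
have p0 := @int_pmf_ge0 _ _ _ P.
have Smass : (\esum_(z in [set: int]) (int_pmf (partial_sum X n) z)%:E = 1)%E.
  by rewrite -S1; apply: eq_esum => z _; rewrite mule1.
apply: le_trans (esum_renyi_ge (p0 _) Slc Smass halpha).
(* [K] is the upper-bound constant relative to [sqdist], twice the variance; its product with the
   constant of the theorem is the [1 / 2] of the lower bound. *)
set K := 2 * ((3 * alpha - 1) / (alpha - 1)).
have c0 : 0 <= (alpha - 1) / (4 * (3 * alpha - 1)).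
  by rewrite divr_ge0 ?(ltW a1')//; lra.
apply: (@le_trans _ _ (((alpha - 1) / (4 * (3 * alpha - 1)))%:E *
    \sum_(i < n) (K%:E * sqdist (int_pmf (X i))))%E).
  rewrite lee_wpmul2l ?lee_fin//; apply: lee_sum => i _.
  rewrite sqdistE; last exact: p0.
  exact: esum_renyi_le (p0 _) (int_pmf_mass (Xint i)) halpha.
rewrite -ge0_sume_distrr; last by move=> i _; apply: sqdist_ge0; exact: p0.
rewrite muleA -EFinM SD.
have -> : \sum_(i < n | (i < n)%N) sqdist (int_pmf (X i)) =
    \sum_(i < n) sqdist (int_pmf (X i)) by apply: eq_bigl => i; rewrite ltn_ord.
have -> : (alpha - 1) / (4 * (3 * alpha - 1)) * K = 2^-1
  by rewrite /K; field; apply/andP; split; lra.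
by [].
Qed.
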